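(* Let $G$ be a group hyperbolic relative to a finite collection $\mathcal{P}$ of slender and LERF subgroups. Suppose that $Q$ is a relatively quasiconvex subgroup of $G$ and $g$ is an element of $G$ not in $Q$. Then there exists a fully quasiconvex subgroup $H$ of $G$ which contains $Q$ and does not contain $g$.
   Context: A subgroup $H$ of a group $G$ is separable if for every $g\in G\setminus H$ there is a homomorphism $\pi$ from $G$ onto a finite group with $\pi(g)\notin\pi(H)$. A group is LERF if every finitely generated subgroup is separable. A group is slender if every subgroup is finitely generated. Relative hyperbolicity. Let $G$ be a group with a finite symmetric generating set $S$ and let $\mathcal{P}=\{P_1,\dots,P_m\}$ be a finite collection of subgroups. $\Gamma(G,\mathcal{P},S)$ is the Cayley graph of $G$ with respect to $S\cup\bigcup\mathcal{P}$; $dist_S$ is the word metric of $S$. For a path $p$, $p_-$ and $p_+$ are its initial and terminal vertices. A $P_i$-component of a path $q$ in $\Gamma(G,\mathcal{P},S)$ is a maximal subpath with at least one edge whose label is a word in the alphabet $P_i$; a $\mathcal{P}$-component is a $P_i$-component for some $i$. Two $\mathcal{P}$-components are connected if their vertices all lie in the same left coset of $P_i$ for some $i$. A path is without backtracking if none of its $\mathcal{P}$-components is connected to a different $\mathcal{P}$-component of it. A vertex of $q$ is phase if it is not an interior vertex of a $\mathcal{P}$-component of $q$. Paths $p,q$ are $k$-similar if $\max\{dist_S(p_-,q_-),dist_S(p_+,q_+)\}\le k$. The pair $(G,\mathcal{P})$ has the Bounded Coset Penetration (BCP) property if for all $\lambda\ge1$, $c\ge0$, $k\ge0$ there is an integer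 $\epsilon=\epsilon(\lambda,c,k)>0$ such that for any two $k$-similar $(\lambda,c)$-quasi-geodesics $p,q$ in $\Gamma(G,\mathcal{P},S)$ without backtracking: (i) the sets of phase vertices of $p$ and $q$ lie in the closed $\epsilon$-neighborhoods of each other with respect to $dist_S$; (ii) if $s$ is a $\mathcal{P}$-component of $p$ with $dist_S(s_-,s_+)>\epsilon$, then some $\mathcal{P}$-component of $q$ is connected to $s$; (iii) if $s,t$ are connected $\mathcal{P}$-components of $p,q$ respectively, then $\max\{dist_S(s_-,t_-),dist_S(s_+,t_+)\}\le\epsilon$. $G$ is relatively hyperbolic, relative to $\mathcal{P}$ (equivalently, $G$ is hyperbolic relative to $\mathcal{P}$) if $\Gamma(G,\mathcal{P},S)$ is $\delta$-hyperbolic for some $\delta\ge 0$ and $(G,\mathcal{P})$ has the BCP property. This is independent of the finite generating set $S$. Relative quasiconvexity. A subgroup $Q<G$ is relatively quasiconvex (relative to $\mathcal{P}$) if there is $\sigma\ge0$ such that for all $f,g\in Q$, every geodesic $p$ from $f$ to $g$ in $\Gamma(G,\mathcal{P},S)$, and every vertex $v$ of $p$, there is $w\in Q$ with $dist_S(v,w)\le\sigma$. A relatively quasiconvex subgroup $H$ of $G$ is fully quasiconvex if for every $P\in\mathcal{P}$ and every $f\in G$, either $H\cap P^f$ is finite or $H\cap P^f$ is a finite index subgroup of $P^f$, where $P^f=fPf^{-1}$. *)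

(* Defs.v *)
From HB Require Import structures.
From mathcomp Require Import all_boot all_order all_fingroup all_algebra.
From mathcomp Require Import boolp classical_sets functions cardinality reals.

Set Implicit Arguments.
Unset Strict Implicit.
Unset Printing Implicit Defensive.

Import Order.TTheory GRing.Theory Num.Theory.

Local Open Scope classical_set_scope.
Local Open Scope group_scope.

(** * Subgroups, finite generation, separability *)

Definition is_subgroup (G : groupType) (H : set G) : Prop :=
  H 1 /\ forall x y, H x -> H y -> H (x * y^-1).

(** [smallest is_subgroup A] is the subgroup generated by [A]. *)
Definition finitely_generated (G : groupType) (H : set G) : Prop :=
  exists2 A : set G, finite_set A & H = smallest (@is_subgroup G) A.

Definition slender (G : groupType) (K : set G) : Prop :=
  forall H : set G, is_subgroup H -> H `<=` K -> finitely_generated H.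

(** Separability of [H] in the group [K], where [K] is itself given as a
    subgroup of [G]: a homomorphism from [K] onto a finite group is a function
    on [G] of which only the restriction to [K] is constrained. *)
Definition separable_in (G : groupType) (K H : set G) : Prop :=
  forall g : G, K g -> ~ H g ->
  exists (F : finGroupType) (pi : G -> F),
    [/\ forall x y, K x -> K y -> pi (x * y) = pi x * pi y,
        pi @` K = setT
      & ~ (pi @` H) (pi g)].

Definition LERF (G : groupType) (K : set G) : Prop :=
  forall H : set G, is_subgroup H -> H `<=` K -> finitely_generated H ->
  separable_in K H.

Definition lcoset_set (G : groupType) (x : G) (K : set G) : set G :=
  [set x * y | y in K].

Definition finite_index (G : groupType) (K L : set G) : Prop :=
  K `<=` L /\ finite_set [set lcoset_set x K | x in L].

(** [conj_set f P] is f P f^-1; this is not the convention of [conjg]. *)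
Definition conj_set (G : groupType) (f : G) (P : set G) : set G :=
  [set f * x * f^-1 | x in P].

Definition symmetric_set (G : groupType) (S : set G) : Prop :=
  forall s, S s -> S s^-1.

Definition generates (G : groupType) (S : set G) : Prop :=
  smallest (@is_subgroup G) S = setT.

(** * Word metrics *)

Definition is_word_length (G : groupType) (X : set G) (x : G) (n : nat) : Prop :=
  exists w : seq G,
    [/\ size w = n, forall s, s \in w -> X s & \prod_(s <- w) s = x].

(** The least length of a word in [X] representing [x^-1 * y]; the default
    value 0 is only taken when there is no such word. *)
Definition word_dist (G : groupType) (X : set G) (x y : G) : nat :=
  xget 0%N [set n | is_word_length X (x^-1 * y) n /\
                    forall k, is_word_length X (x^-1 * y) k -> (n <= k)%N].

(** * Paths in the Cayley graph with respect to S and the P_i *)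

Section Paths.

Context (G : groupType) (m : nat).

(** A letter is an element of [G] tagged with the alphabet it comes from:
    [None] for S and [Some i] for P_i.  Thus the alphabets are treated as
    disjoint, so that "a word in the alphabet P_i" is unambiguous when the P_i
    have nontrivial (finite) intersections or meet S. *)
Definition letter : Type := (option 'I_m * G)%type.

(** A combinatorial path is its initial vertex together with its label. *)
Record cpath := CPath { cp_start : G ; cp_label : seq letter }.

Definition cp_len (p : cpath) : nat := size (cp_label p).

Definition cp_vertex (p : cpath) (k : nat) : G :=
  cp_start p * \prod_(l <- take k (cp_label p)) l.2.

Definition cp_end (p : cpath) : G := cp_vertex p (cp_len p).

Definition cp_tag (p : cpath) (k : nat) : option 'I_m :=
  (nth (None, 1) (cp_label p) k).1.

(** The subpath of [p] between positions [s.1] and [s.2] is encoded by the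
    pair [s]; here it is nontrivial with label a word in the alphabet P_i. *)
Definition is_peripheral_subpath (i : 'I_m) (p : cpath) (s : nat * nat) : Prop :=
  (s.1 < s.2 <= cp_len p)%N /\
  forall k, (s.1 <= k < s.2)%N -> cp_tag p k = Some i.

Definition is_component_of (i : 'I_m) (p : cpath) (s : nat * nat) : Prop :=
  is_peripheral_subpath i p s /\
  forall t, (t.1 <= s.1)%N -> (s.2 <= t.2)%N ->
    is_peripheral_subpath i p t -> t = s.

Definition is_component (p : cpath) (s : nat * nat) : Prop :=
  exists i, is_component_of i p s.

(** Phase vertices are positions on the path, not elements of [G]: the same
    element may be visited several times. *)
Definition is_phase (p : cpath) (k : nat) : Prop :=
  (k <= cp_len p)%N /\ forall s, is_component p s -> ~ (s.1 < k < s.2)%N.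

End Paths.

Section RelativelyHyperbolic.

Context (R : realType) (G : groupType) (S : set G) (m : nat).
Context (P : 'I_m -> set G).

(** Cayley graphs have no loops, hence the identity is not used as a letter. *)
Definition is_cpath (p : cpath G m) : Prop :=
  forall l, l \in cp_label p ->
    l.2 <> 1 /\ match l.1 with None => S l.2 | Some i => P i l.2 end.

Definition cayley_dist : G -> G -> nat :=
  word_dist (S `|` \bigcup_i P i).

Definition is_geodesic (p : cpath G m) (x y : G) : Prop :=
  [/\ is_cpath p, cp_start p = x, cp_end p = y
    & cp_len p = cayley_dist x y].

Definition is_quasi_geodesic (lambda c : R) (p : cpath G m) : Prop :=
  is_cpath p /\
  forall a b, (a <= b <= cp_len p)%N ->
    ((b - a)%N%:R <=
       lambda * (cayley_dist (cp_vertex p a) (cp_vertex p b))%:R + c)%R.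

(** Geodesic triangles with vertices in [G] are delta-slim. *)
Definition is_hyperbolic (delta : R) : Prop :=
  forall (x y z : G) (p q r : cpath G m),
    is_geodesic p x y -> is_geodesic q y z -> is_geodesic r x z ->
  forall a, (a <= cp_len p)%N ->
    (exists2 b, (b <= cp_len q)%N &
       ((cayley_dist (cp_vertex p a) (cp_vertex q b))%:R <= delta)%R) \/
    (exists2 b, (b <= cp_len r)%N &
       ((cayley_dist (cp_vertex p a) (cp_vertex r b))%:R <= delta)%R).

Definition connected_components (p : cpath G m) (s : nat * nat)
    (q : cpath G m) (t : nat * nat) : Prop :=
  exists (i : 'I_m) (x : G),
    (forall k, (s.1 <= k <= s.2)%N -> lcoset_set x (P i) (cp_vertex p k)) /\
    (forall k, (t.1 <= k <= t.2)%N -> lcoset_set x (P i) (cp_vertex q k)).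

Definition without_backtracking (p : cpath G m) : Prop :=
  forall s t, is_component p s -> is_component p t ->
    connected_components p s p t -> s = t.

Definition similar (k : R) (p q : cpath G m) : Prop :=
  ((maxn (word_dist S (cp_start p) (cp_start q))
         (word_dist S (cp_end p) (cp_end q)))%:R <= k)%R.

Definition phase_near (eps : nat) (p q : cpath G m) : Prop :=
  forall a, is_phase p a -> exists2 b, is_phase q b &
    (word_dist S (cp_vertex p a) (cp_vertex q b) <= eps)%N.

Definition BCP : Prop :=
  forall lambda c k : R, (1 <= lambda)%R -> (0 <= c)%R -> (0 <= k)%R ->
  exists2 eps : nat, (0 < eps)%N &
  forall p q : cpath G m,
    is_quasi_geodesic lambda c p -> is_quasi_geodesic lambda c q ->
    without_backtracking p -> without_backtracking q -> similar k p q ->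
  [/\ phase_near eps p q /\ phase_near eps q p,
      forall s, is_component p s ->
        (eps < word_dist S (cp_vertex p s.1) (cp_vertex p s.2))%N ->
        exists2 t, is_component q t & connected_components p s q t
    & forall s t, is_component p s -> is_component q t ->
        connected_components p s q t ->
        (maxn (word_dist S (cp_vertex p s.1) (cp_vertex q t.1))
              (word_dist S (cp_vertex p s.2) (cp_vertex q t.2)) <= eps)%N].

Definition relatively_hyperbolic : Prop :=
  (exists2 delta : R, (0 <= delta)%R & is_hyperbolic delta) /\ BCP.

Definition relatively_quasiconvex (Q : set G) : Prop :=
  is_subgroup Q /\
  exists2 sigma : R, (0 <= sigma)%R &
  forall (f g : G) (p : cpath G m), Q f -> Q g -> is_geodesic p f g ->
  forall a, (a <= cp_len p)%N ->
  exists2 w, Q w & ((word_dist S (cp_vertex p a) w)%:R <= sigma)%R.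

Definition fully_quasiconvex (H : set G) : Prop :=
  relatively_quasiconvex H /\
  forall (i : 'I_m) (f : G),
    finite_set (H `&` conj_set f (P i)) \/
    finite_index (H `&` conj_set f (P i)) (conj_set f (P i)).

End RelativelyHyperbolic.

(* Main.v *)
(** The infinite [P i] lie in finitely many maximal parabolic subgroups [E].  A
    geodesic of the relative Cayley graph that avoids a coset [Y] of such an [E]
    moves the point where geodesics enter [Y] by a bounded amount only: this follows
    from slim quadrilaterals and coset penetration.

    Let [sigma] be the quasiconvexity constant of [Q].  For each [Q]-orbit of cosets
    [f E] that meet the [sigma]-neighbourhood of [Q], choose a representative and a
    finite-index subgroup [N] of [f E f^-1] that contains [Q `&` f E f^-1] but no
    other short element; slenderness and LERF allow this.  Let [H] be generated by
    [Q] and these [N].  A reduced product [q_0 r_1 q_1 ... r_n q_n] with [r_k] in the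
    [N] and not in [Q] determines a sequence of cosets, and the parts of [Q]-cosets
    before and after such a coset approach it in places that are far apart.  So, as in
    a ping-pong argument, any geodesic between the ends of the product crosses these
    cosets one after the other, and it stays close to cosets of [Q] in between.

    It follows that [H] is relatively quasiconvex, that [g] is not in [H] if the [N]
    avoid long enough elements (a product with [n > 0] has a jump longer than any in a
    fixed geodesic from [1] to [g]), and that a coset [f E] which is penetrated deeply
    by a geodesic with ends in [H] is the translate by an element of [H] of a chosen
    coset; then [H] contains a conjugate of the corresponding [N]. *)
Require Import Defs.
From HB Require Import structures.
From mathcomp Require Import all_boot all_order all_fingroup all_algebra.
From mathcomp Require Import boolp classical_sets functions cardinality reals.
From mathcomp Require Import zify.

Set Implicit Arguments.
Unset Strict Implicit.
Unset Printing Implicit Defensive.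

Import Order.TTheory GRing.Theory Num.Theory.

Local Open Scope classical_set_scope.
Local Open Scope group_scope.

Ltac gsimp := rewrite ?(invgM, invgK, mulgA, mulgK, mulgVK, mulVg, mulgV, mul1g, mulg1, invg1).

(** * Subgroups, conjugates and left cosets *)

Section Subgroups.

Context (G : groupType).
Implicit Types A B H : set G.

Lemma subgroup1 H : is_subgroup H -> H 1.
Proof. by case. Qed.

Lemma subgroupV H x : is_subgroup H -> H x -> H x^-1.
Proof. by case=> H1 HD Hx; have := HD _ _ H1 Hx; rewrite mul1g. Qed.

Lemma subgroupM H x y : is_subgroup H -> H x -> H y -> H (x * y).
Proof.
move=> HH Hx Hy; have := HH.2 _ _ Hx (subgroupV HH Hy).
by rewrite invgK.
Qed.

Lemma subgroupI A B : is_subgroup A -> is_subgroup B -> is_subgroup (A `&` B).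
Proof.
move=> HA HB; split; first by split; apply: subgroup1.
by move=> x y [Ax Bx] [Ay By]; split; [apply HA.2|apply HB.2].
Qed.

Lemma subgroupMl H x y : is_subgroup H -> H x -> H (x * y) <-> H y.
Proof.
move=> HH Hx; split; last exact: subgroupM.
by move=> Hxy; have := subgroupM HH (subgroupV HH Hx) Hxy; rewrite mulKg.
Qed.

Lemma conj_setP f A x : conj_set f A x <-> A (f^-1 * x * f).
Proof.
split; first by case=> y Ay <-; gsimp.
by move=> Ax; exists (f^-1 * x * f) => //; gsimp.
Qed.

Lemma lcoset_setP f A x : lcoset_set f A x <-> A (f^-1 * x).
Proof.
split; first by case=> y Ay <-; rewrite mulKg.
by move=> Ax; exists (f^-1 * x) => //; rewrite mulVKg.
Qed.

Lemma subgroup_conj f A : is_subgroup A -> is_subgroup (conj_set f A).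
Proof.
move=> HA; split; first by apply/conj_setP; gsimp; apply: subgroup1.
move=> x y /conj_setP Ax /conj_setP Ay; apply/conj_setP.
by have := HA.2 _ _ Ax Ay; gsimp.
Qed.

Lemma lcoset_set_eq f x A : is_subgroup A -> lcoset_set f A x ->
  lcoset_set f A = lcoset_set x A.
Proof.
move=> HA /lcoset_setP Afx; apply/seteqP; split=> y /lcoset_setP Ay;
  apply/lcoset_setP.
  have := subgroupM HA (subgroupV HA Afx) Ay; by gsimp.
have := subgroupM HA Afx Ay; by gsimp.
Qed.

End Subgroups.

(** Finiteness is a separate layer, so that the same lemmas on word metrics serve [S] and the
    possibly infinite alphabet of the relative Cayley graph. *)
Record sym_gen_set (G : groupType) := SymGenSet {
  sgs_set :> set G;
  sgs_symmetric : symmetric_set sgs_set;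
  sgs_generates : generates sgs_set
}.

(** * Word metrics of symmetric generating sets *)

Section WordMetric.

Context (G : groupType) (X : sym_gen_set G).

Lemma is_word_length1 : is_word_length X 1 0.
Proof. by exists [::]; rewrite big_nil. Qed.

Lemma is_word_lengthM x y n k : is_word_length X x n -> is_word_length X y k ->
  is_word_length X (x * y) (n + k).
Proof.
move=> [w [sw wX wx]] [v [sv vX vy]]; exists (w ++ v).
rewrite size_cat sw sv big_cat /= wx vy; split=> // s.
by rewrite mem_cat => /orP[/wX|/vX].
Qed.

Lemma is_word_lengthV x n : is_word_length X x n -> is_word_length X x^-1 n.
Proof.
move=> [w [<- wX <-]] {x n}; elim: w wX => [|s w IH] wX.
  by rewrite big_nil invg1; apply: is_word_length1.
rewrite big_cons invgM /= -addn1; apply: is_word_lengthM.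
  by apply: IH => t tw; apply: wX; rewrite in_cons tw orbT.
exists [:: s^-1]; split=> //; last by rewrite big_seq1.
by move=> t; rewrite inE => /eqP ->; apply: sgs_symmetric; apply: wX; rewrite mem_head.
Qed.

Lemma is_word_length_ex x : exists n, is_word_length X x n.
Proof.
suff : [set x | exists n, is_word_length X x n] x by [].
have : @setT G x by []; rewrite -(sgs_generates X); apply; split.
  split; first by exists 0%N; apply: is_word_length1.
  move=> y z [n yn] [k zk]; exists (n + k)%N; apply: is_word_lengthM => //.
  exact: is_word_lengthV.
move=> s Xs; exists 1%N; exists [:: s]; split=> //; last by rewrite big_seq1.
by move=> t; rewrite inE => /eqP ->.
Qed.

Lemma word_distP x y : is_word_length X (x^-1 * y) (word_dist X x y) /\
  forall k, is_word_length X (x^-1 * y) k -> (word_dist X x y <= k)%N.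
Proof.
pose Q n := `[< is_word_length X (x^-1 * y) n >].
have exQ : exists n, Q n.
  by have [n ?] := is_word_length_ex (x^-1 * y); exists n; apply/asboolP.
apply: (@xgetPex _ 0%N [set n | is_word_length X (x^-1 * y) n /\
                    forall k, is_word_length X (x^-1 * y) k -> (n <= k)%N]).
case: (ex_minnP exQ) => n /asboolP Qn nmin; exists n; split=> // k Qk.
by apply: nmin; apply/asboolP.
Qed.

Lemma word_dist_le x y k :
  is_word_length X (x^-1 * y) k -> (word_dist X x y <= k)%N.
Proof. exact: (word_distP x y).2. Qed.

Lemma word_dist1E x y : word_dist X x y = word_dist X 1 (x^-1 * y).
Proof. by rewrite /word_dist invg1 mul1g. Qed.

Lemma word_distMl g x y : word_dist X (g * x) (g * y) = word_dist X x y.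
Proof. by rewrite word_dist1E [RHS]word_dist1E; gsimp. Qed.

Lemma word_distxx x : word_dist X x x = 0%N.
Proof.
apply/eqP; rewrite -leqn0; apply: word_dist_le; rewrite mulVg.
exact: is_word_length1.
Qed.

Lemma word_distC x y : word_dist X x y = word_dist X y x.
Proof.
have H a b : (word_dist X a b <= word_dist X b a)%N.
  apply: word_dist_le; have := is_word_lengthV (word_distP b a).1; by gsimp.
by apply/eqP; rewrite eqn_leq !H.
Qed.

Lemma word_dist_triangle y x z :
  (word_dist X x z <= word_dist X x y + word_dist X y z)%N.
Proof.
apply: word_dist_le.
have := is_word_lengthM (word_distP x y).1 (word_distP y z).1; by gsimp.
Qed.

Lemma word_dist0 x y : word_dist X x y = 0%N -> x = y.
Proof.
move=> d0; have [[w [sw _ wx]] _] := word_distP x y; move: sw wx.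
rewrite d0 => /size0nil ->; rewrite big_nil => e.
by rewrite -[LHS]mulg1 e mulVKg.
Qed.

Lemma word_dist1 x y : (word_dist X x y <= 1)%N <-> x = y \/ (X : set G) (x^-1 * y).
Proof.
split; last first.
  case=> [->|Xxy]; first by rewrite word_distxx.
  apply: word_dist_le; exists [:: x^-1 * y]; split=> //.
    by move=> t; rewrite inE => /eqP ->.
  by rewrite big_seq1.
rewrite leq_eqVlt ltnS leqn0 => /orP[/eqP d1|/eqP /word_dist0]; last by left.
right; have [[w [sw wX wx]] _] := word_distP x y; move: sw wX wx.
rewrite d1; case: w => [|s [|? ?]] // _ wX; rewrite big_seq1 => <-.
by apply: wX; rewrite mem_head.
Qed.

Lemma word_distV x : word_dist X 1 x^-1 = word_dist X 1 x.
Proof. by rewrite word_distC word_dist1E invgK mulg1. Qed.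

Lemma word_distM x y :
  (word_dist X 1 (x * y) <= word_dist X 1 x + word_dist X 1 y)%N.
Proof.
apply: (leq_trans (word_dist_triangle x _ _)).
by rewrite (word_dist1E x) mulKg.
Qed.

(** The partial products of a shortest word: if two of them were closer than their positions, the
    triangle inequality would contradict the distance of the ends. *)
Lemma word_dist_geodesic x y : exists u : nat -> G,
  [/\ u 0%N = x, u (word_dist X x y) = y &
      forall i j, (i <= j <= word_dist X x y)%N ->
        word_dist X (u i) (u j) = (j - i)%N].
Proof.
have [[w [sw wX wx]] _] := word_distP x y.
pose u k := x * \prod_(s <- take k w) s.
have u0 : u 0%N = x by rewrite /u take0 big_nil mulg1.
have un : u (word_dist X x y) = y.
  by rewrite /u -sw take_size wx mulVKg.
exists u; split=> // i j /andP[ij jn].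
have le a b : (a <= b <= word_dist X x y)%N ->
    (word_dist X (u a) (u b) <= b - a)%N.
  move=> /andP[ab bn]; apply: word_dist_le.
  exists (drop a (take b w)); split.
  - by rewrite size_drop size_takel // sw.
  - by move=> s /mem_drop /mem_take /wX.
  have -> : u b = u a * \prod_(s <- drop a (take b w)) s.
    by rewrite /u -{1}(cat_take_drop a (take b w)) big_cat /= take_takel // mulgA.
  by rewrite mulKg.
have h1 := le 0%N i; have h2 := le i j; have h3 := le j (word_dist X x y).
have t1 := word_dist_triangle (u i) x y.
have t2 := word_dist_triangle (u j) (u i) y.
rewrite u0 in h1; rewrite un in h3.
by move: h1 h2 h3; rewrite ij jn leqnn (leq_trans ij jn) /=; lia.
Qed.

Lemma ball_finite n : finite_set X ->
  finite_set [set x | (word_dist X 1 x <= n)%N].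
Proof.
move=> Xfin; elim: n => [|n IH].
  apply: (@sub_finite_set _ _ [set 1]); last exact: finite_set1.
  by move=> x /=; rewrite leqn0 => /eqP /word_dist0 ->.
apply: (@sub_finite_set _ _ ([set 1] `|`
    (fun p => p.1 * p.2) @` (X `*` [set x | (word_dist X 1 x <= n)%N]))).
  move=> x /= xn; have [[w [sw wX wx]] _] := word_distP 1 x.
  move: sw wX wx; rewrite invg1 mul1g; case: w => [|s w] sw wX wx.
    by left; rewrite -wx big_nil.
  right; exists (s, \prod_(t <- w) t); last by rewrite -wx big_cons.
  split; first by apply: wX; rewrite mem_head.
  apply: (@leq_trans (size w)); last by rewrite -ltnS; apply: leq_trans xn; rewrite -sw.
  apply: word_dist_le; exists w; split=> //; last by rewrite invg1 mul1g.
  by move=> t tw; apply: wX; rewrite in_cons tw orbT.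
rewrite finite_setU; split; first exact: finite_set1.
by apply: finite_image; apply: finite_setX.
Qed.

End WordMetric.

(** * Coarse geometry of the word metric *)

(** Makes constants uniform that depend on a point of a ball, on an element of a finite quotient or
    on an index of [P]. *)
Lemma uniform_bound (T : choiceType) (A : set T) (Q : T -> nat -> Prop) :
  finite_set A -> (forall t n k, (n <= k)%N -> Q t n -> Q t k) ->
  (forall t, A t -> exists n, Q t n) -> exists n, forall t, A t -> Q t n.
Proof.
move=> /finite_seqP [s ->] Qmono; elim: s => [|x s IH] exQ.
  by exists 0%N => t; rewrite /= in_nil.
have [t ts|n Hn] := IH; first by apply: exQ; rewrite /= in_cons ts orbT.
have [|k Hk] := exQ x; first by rewrite /= mem_head.
exists (maxn n k) => t /=; rewrite in_cons => /orP[/eqP ->|ts].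
  by apply: Qmono Hk; apply: leq_maxr.
by apply: (Qmono _ n); [apply: leq_maxl|apply: Hn].
Qed.

Record fin_gen_set (G : groupType) := FinGenSet {
  fgs_sym_gen_set :> sym_gen_set G;
  fgs_finite : finite_set fgs_sym_gen_set
}.

Definition wlen (G : groupType) (S : set G) (g : G) : nat := word_dist S 1 g.

(* Convertible instances of the group operations need not be syntactically
   equal, so the lengths are generalized before calling [lia]. *)
Ltac len_lia :=
  cbv beta in *; repeat match goal with H : is_true ?P |- _ =>
    match P with context [wlen _ _] => move: H end end;
  repeat match goal with |- context [wlen ?T ?y] =>
    let l := constr:(wlen T y) in move: l => ? end;
  lia.

Section Coarse.

Context (G : groupType) (S : fin_gen_set G).

Local Notation wlen := (wlen S).

Lemma wlen_dist x y : word_dist S x y = wlen (x^-1 * y).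
Proof. exact: word_dist1E. Qed.

Lemma wlen1 : wlen 1 = 0%N.
Proof. exact: word_distxx. Qed.

Lemma wlenV x : wlen x^-1 = wlen x.
Proof. exact: word_distV. Qed.

Lemma wlenM x y : (wlen (x * y) <= wlen x + wlen y)%N.
Proof. exact: word_distM. Qed.

Lemma wlenC x y : wlen (x^-1 * y) = wlen (y^-1 * x).
Proof. by rewrite -wlenV; gsimp. Qed.

Lemma wlen_triangle y x z :
  (wlen (x^-1 * z) <= wlen (x^-1 * y) + wlen (y^-1 * z))%N.
Proof. by have := wlenM (x^-1 * y) (y^-1 * z); gsimp. Qed.

Lemma finite_wlen_ball n : finite_set [set x | (wlen x <= n)%N].
Proof. exact/ball_finite/fgs_finite. Qed.

(** Coarse containment. For subgroups it amounts to the intersection having finite index in [A], so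
    this preorder carries all commensurability arguments. *)
Definition cov (A B : set G) := exists n, forall a, A a ->
  exists2 b, B b & (wlen (b^-1 * a) <= n)%N.

Definition unbounded (A : set G) := forall n, exists2 a, A a & (n < wlen a)%N.

Lemma cov_sub A B : A `<=` B -> cov A B.
Proof. by move=> AB; exists 0%N => a /AB Ba; exists a; rewrite // mulVg wlen1. Qed.

Lemma cov_refl A : cov A A.
Proof. exact: cov_sub. Qed.

Lemma cov_trans B A C : cov A B -> cov B C -> cov A C.
Proof.
move=> [n AB] [k BC]; exists (k + n)%N => a /AB[b /BC[c Cc ck] bn].
by exists c => //; apply: leq_trans (wlen_triangle b _ _) _; apply: leq_add.
Qed.

Lemma cov_subl A B C : A `<=` B -> cov B C -> cov A C.
Proof. by move=> /cov_sub AB; apply: cov_trans. Qed.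

Lemma cov_subr A B C : B `<=` C -> cov A B -> cov A C.
Proof. by move=> /cov_sub BC AB; apply: cov_trans BC. Qed.

Lemma cov_lcoset f A B : cov A B -> cov (lcoset_set f A) (lcoset_set f B).
Proof.
move=> [n AB]; exists n => _ [a /AB[b Bb bn] <-]; exists (f * b).
  by exists b.
by gsimp.
Qed.

Lemma cov_conj_lcoset f A : cov (conj_set f A) (lcoset_set f A).
Proof.
exists (wlen f) => _ [a Aa <-]; exists (f * a); first by exists a.
by gsimp; rewrite wlenV.
Qed.

Lemma cov_lcoset_conj f A : cov (lcoset_set f A) (conj_set f A).
Proof.
exists (wlen f) => _ [a Aa <-]; exists (f * a * f^-1); first by exists a.
by gsimp.
Qed.

Lemma cov_conj f A B : cov A B -> cov (conj_set f A) (conj_set f B).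
Proof.
move=> AB; apply: cov_trans (cov_conj_lcoset _ _) _.
by apply: cov_trans (cov_lcoset_conj _ _); apply: cov_lcoset.
Qed.

(** For each of the finitely many short [t] fix a pair with [b0^-1 * a0 = t], if there is one. A
    pair [a], [b] with the same [t] satisfies [a * a0^-1 = b * b0^-1]; this element lies in both
    subgroups, at distance [wlen a0] from [a]. *)
Lemma subgroup_near_both A B n : is_subgroup A -> is_subgroup B ->
  exists k, forall a b, A a -> B b -> (wlen (b^-1 * a) <= n)%N ->
  exists2 d, (A `&` B) d & (wlen (d^-1 * a) <= k)%N.
Proof.
move=> HA HB.
have [|||k Hk] := @uniform_bound G [set t | (wlen t <= n)%N]
  (fun t k => forall a b, A a -> B b -> b^-1 * a = t ->
  exists2 d, (A `&` B) d & (wlen (d^-1 * a) <= k)%N).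
- exact: finite_wlen_ball.
- move=> t i j ij Hi a b Aa Bb ab; have [d ? dk] := Hi a b Aa Bb ab.
  by exists d => //; apply: leq_trans ij.
- move=> t tn.
  have [[[a0 b0] [Aa0 Bb0 e0]]|no] :=
    pselect (exists p : G * G, [/\ A p.1, B p.2 & p.2^-1 * p.1 = t]).
    exists (wlen a0) => a b Aa Bb e; exists (a * a0^-1); last by gsimp.
    split; first by apply HA.2.
    suff -> : a * a0^-1 = b * b0^-1 by apply HB.2.
    move: e0 e => /= e0 e; rewrite -[a](mulVKg b) e -e0; by gsimp.
  by exists 0%N => a b Aa Bb e; case: no; exists (a, b).
- by exists k => a b Aa Bb tn; exact: (Hk _ tn a b).
Qed.

Lemma cov_subgroupI A B : is_subgroup A -> is_subgroup B -> cov A B ->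
  cov A (A `&` B).
Proof.
move=> HA HB [n AB]; have [k Hk] := subgroup_near_both n HA HB.
by exists k => a Aa; have [b Bb bn] := AB a Aa; apply: Hk bn.
Qed.

Lemma unbounded_cov A B : unbounded A -> cov A B -> unbounded B.
Proof.
move=> uA [n AB] k; have [a Aa ak] := uA (n + k)%N.
have [b Bb bn] := AB a Aa; exists b => //.
have := wlenM b (b^-1 * a); rewrite mulVKg; len_lia.
Qed.

Lemma unbounded_sub A B : A `<=` B -> unbounded A -> unbounded B.
Proof. by move=> AB uA; apply: unbounded_cov uA _; apply: cov_sub. Qed.

Lemma unbounded_coarseI A B C : is_subgroup B -> is_subgroup C ->
  unbounded A -> cov A B -> cov A C -> unbounded (B `&` C).
Proof.
move=> HB HC uA [n AB] [k AC]; have [l Hl] := subgroup_near_both (k + n) HB HC.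
apply: unbounded_cov uA _; exists (l + n)%N => a Aa.
have [b Bb bn] := AB a Aa; have [c Cc ck] := AC a Aa.
have [|d BCd dl] := Hl b c Bb Cc.
  apply: leq_trans (wlen_triangle a _ _) _; apply: leq_add => //.
  by rewrite wlenC.
by exists d => //; apply: leq_trans (wlen_triangle b _ _) _; apply: leq_add.
Qed.

Lemma unbounded_conj f A : unbounded A -> unbounded (conj_set f A).
Proof.
move=> uA n; have [a Aa an] := uA (n + 2 * wlen f)%N.
exists (f * a * f^-1); first by exists a.
have := wlenM (f^-1 * (f * a * f^-1)) f; have := wlenM f^-1 (f * a * f^-1).
have -> : f^-1 * (f * a * f^-1) * f = a by gsimp.
by rewrite wlenV; len_lia.
Qed.

Lemma bounded_finite A : ~ unbounded A -> finite_set A.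
Proof.
move=> /existsNP[n nA]; apply: sub_finite_set (finite_wlen_ball n) => a Aa /=.
by rewrite leqNgt; apply/negP => an; apply: nA; exists a.
Qed.

Lemma finite_index_cov A B : is_subgroup A -> is_subgroup B -> B `<=` A ->
  cov A B -> finite_index B A.
Proof.
move=> HA HB BA [n AB]; split=> //.
apply: (@sub_finite_set _ _ ((fun t => lcoset_set t B) @` [set x | (wlen x <= n)%N])).
  (* [cov] bounds representatives of right cosets; inverting [x] turns this into the short
     representative [x * b] of a left coset. *)
  move=> _ [x Ax <-]; have [b Bb bn] := AB _ (subgroupV HA Ax).
  exists (x * b) => /=; first by rewrite -wlenV invgM.
  by apply: lcoset_set_eq => //; apply/lcoset_setP; gsimp; apply: subgroupV.
exact/finite_image/finite_wlen_ball.
Qed.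

(** B. H. Neumann's lemma on coverings by finitely many cosets, in coarse form:
    the cosets are replaced by neighbourhoods of the subgroups. *)
Lemma neumann (I : eqType) (B : I -> set G) (s : seq I) A n :
  is_subgroup A -> (forall i, is_subgroup (B i)) ->
  (forall a, A a -> exists i b, [/\ i \in s, B i b & (wlen (b^-1 * a) <= n)%N]) ->
  exists2 i, i \in s & cov A (B i).
Proof.
move=> HA HB; elim: s n => [|i s IH] n As.
  by have [i [b []]] := As _ (subgroup1 HA).
have [ABi|nABi] := pselect (cov A (B i)); first by exists i; rewrite ?mem_head.
have [k Hk] := subgroup_near_both n HA (HB i).
(* [a] is far from [B i], and so is [d * a] for every [d] in [A] and [B i]. Hence [d * a] is close
   to one of the other subgroups, and so is each [c] that was close to [B i]. *)
have /existsNP[a /not_implyP[Aa far]] := (forallNP _).2 nABi n.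
suff [j js Aj] : exists2 j, j \in s & cov A (B j).
  by exists j => //; rewrite in_cons js orbT.
apply: (IH (n + wlen a + k)%N) => c Ac.
have [j [b []]] := As c Ac; rewrite in_cons => /orP[/eqP ->|js] Bb bn; last first.
  by exists j, b; split=> //; len_lia.
have [d [Ad Bd] dk] := Hk c b Ac Bb bn.
have [j' [b' []]] := As (d * a) (subgroupM HA Ad Aa).
rewrite in_cons => /orP[/eqP ->|js] Bb' bn'.
  case: far; exists (d^-1 * b'); last by move: bn'; gsimp.
  by apply: subgroupM => //; apply: subgroupV.
exists j', b'; split=> //.
have := wlen_triangle (d * a) b' c; have := wlen_triangle d (d * a) c.
have -> : (d * a)^-1 * d = a^-1 by gsimp.
by rewrite wlenV; len_lia.
Qed.

End Coarse.

(** * Paths and geodesics of the relative Cayley graph *)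

Record rel_hyp_family (R : realType) (G : groupType) (S : set G) (m : nat) :=
  RelHypFamily {
    rhf_set :> 'I_m -> set G;
    rhf_subgroup : forall i, is_subgroup (rhf_set i);
    rhf_hyperbolic : relatively_hyperbolic R S rhf_set
  }.

Section Geodesics.

Context (R : realType) (G : groupType) (S : fin_gen_set G) (m : nat).
Context (P : rel_hyp_family R S m).

Local Notation X := ((S : set G) `|` \bigcup_i P i).
Local Notation d := (cayley_dist S P).

Lemma alphabet_symmetric : symmetric_set X.
Proof.
move=> x [Sx|[i _ Pix]]; first by left; apply: sgs_symmetric.
by right; exists i => //; apply: subgroupV => //; exact: rhf_subgroup.
Qed.

Lemma alphabet_generates : generates X.
Proof.
rewrite /generates -subTset -(sgs_generates S) => x Sx A [HA XA].
by apply: Sx; split=> // s Ss; apply: XA; left.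
Qed.

Definition alphabet : sym_gen_set G :=
  SymGenSet alphabet_symmetric alphabet_generates.

Lemma cdistC x y : d x y = d y x.
Proof. exact: (@word_distC _ alphabet). Qed.

Lemma cdistMl g x y : d (g * x) (g * y) = d x y.
Proof. exact: (@word_distMl _ alphabet). Qed.

Lemma cdistxx x : d x x = 0%N.
Proof. exact: (@word_distxx _ alphabet). Qed.

Lemma cdist_triangle y x z : (d x z <= d x y + d y z)%N.
Proof. exact: (@word_dist_triangle _ alphabet). Qed.

Lemma cdist1 x y : (d x y <= 1)%N <-> x = y \/ X (x^-1 * y).
Proof. exact: (@word_dist1 _ alphabet). Qed.

Lemma cdist0 x y : d x y = 0%N -> x = y.
Proof. exact: (@word_dist0 _ alphabet). Qed.

Lemma cdist_P i x y : P i (x^-1 * y) -> (d x y <= 1)%N.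
Proof. by move=> Pixy; apply/cdist1; right; right; exists i. Qed.

(** Geodesics are handled as vertex sequences, of which only the values up to [n] matter; labels are
    chosen only when slimness or coset penetration is invoked. *)
Definition geod (u : nat -> G) (n : nat) :=
  forall i j, (i <= j <= n)%N -> d (u i) (u j) = (j - i)%N.

Lemma geod_ex x y : exists u n, [/\ geod u n, u 0%N = x & u n = y].
Proof.
have [u [u0 un ug]] := word_dist_geodesic alphabet x y.
by exists u, (d x y); split.
Qed.

Lemma geod_rev u n : geod u n -> geod (fun k => u (n - k)%N) n.
Proof. by move=> ug i j /andP[ij jn]; rewrite cdistC ug; lia. Qed.

Lemma geod_shift u n a b : geod u n -> (a <= b <= n)%N ->
  geod (fun k => u (a + k)%N) (b - a).
Proof. by move=> ug abn i j ijn; rewrite ug; lia. Qed.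

Lemma geod_lcoset u n i a b : geod u n -> (a <= b <= n)%N ->
  P i ((u a)^-1 * u b) -> (b <= a.+1)%N.
Proof. by move=> ug abn /cdist_P; rewrite ug //; lia. Qed.

Lemma path_cdist u n : (forall k, (k < n)%N -> (d (u k) (u k.+1) <= 1)%N) ->
  forall i j, (i <= j <= n)%N -> (d (u i) (u j) <= j - i)%N.
Proof.
move=> u1 i; elim=> [|j IH] ijn.
  have -> : i = 0%N by lia.
  by rewrite cdistxx.
have [<-|ij] := eqVneq i j.+1; first by rewrite cdistxx.
have h : (j < n)%N by lia.
by have := cdist_triangle (u j) (u i) (u j.+1); have := u1 j h; move: IH; lia.
Qed.

Definition letter_ok (t : option 'I_m) (x : G) :=
  x <> 1 /\ match t with None => (S : set G) x | Some i => P i x end.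

Lemma cp_vertexS (p : cpath G m) k : (k < cp_len p)%N ->
  cp_vertex p k.+1 = cp_vertex p k * (nth (None, 1) (cp_label p) k).2.
Proof.
move=> kp; rewrite /cp_vertex (take_nth (None, 1)) //.
by rewrite -cats1 big_cat /= big_seq1 mulgA.
Qed.

Lemma geodesic_geod p x y : is_geodesic S P p x y ->
  [/\ geod (cp_vertex p) (cp_len p), cp_vertex p 0 = x & cp_vertex p (cp_len p) = y].
Proof.
case=> [pP p0 pe plen].
have v0 : cp_vertex p 0 = x by rewrite /cp_vertex take0 big_nil mulg1.
split=> // i j ijn.
have up : forall k, (k < cp_len p)%N -> (d (cp_vertex p k) (cp_vertex p k.+1) <= 1)%N.
  move=> k kp; apply/cdist1; right; rewrite cp_vertexS // mulKg.
  have := pP _ (mem_nth (None, 1) kp); case: (nth _ _ _) => [[i'|] g] /= [_ h].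
    by right; exists i'.
  by left.
have le := path_cdist up.
have h1 := le 0%N i; have h2 := le i j; have h3 := le j (cp_len p).
have t1 := cdist_triangle (cp_vertex p i) x y.
have t2 := cdist_triangle (cp_vertex p j) (cp_vertex p i) y.
rewrite v0 in h1; rewrite -/(cp_end p) pe in h3.
by move: h1 h2 h3; rewrite -plen in t1; lia.
Qed.

Definition mkpath (u : nat -> G) (tau : nat -> option 'I_m) n : cpath G m :=
  CPath (u 0%N) [seq (tau k, (u k)^-1 * u k.+1) | k <- iota 0 n].

Lemma cp_len_mkpath u tau n : cp_len (mkpath u tau n) = n.
Proof. by rewrite /cp_len size_map size_iota. Qed.

Lemma cp_vertex_mkpath u tau n k : (k <= n)%N -> cp_vertex (mkpath u tau n) k = u k.
Proof.
elim: k => [|k IH] kn; first by rewrite /cp_vertex take0 big_nil mulg1.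
rewrite cp_vertexS ?cp_len_mkpath // IH; last exact: ltnW.
by rewrite (nth_map 0%N) ?size_iota // nth_iota //= add0n mulVKg.
Qed.

Lemma cp_tag_mkpath u tau n k : (k < n)%N -> cp_tag (mkpath u tau n) k = tau k.
Proof.
by move=> kn; rewrite /cp_tag (nth_map 0%N) ?size_iota // nth_iota //= add0n.
Qed.

Definition labelled u tau n :=
  forall k, (k < n)%N -> letter_ok (tau k) ((u k)^-1 * u k.+1).

Lemma mkpath_is_cpath u tau n : labelled u tau n -> is_cpath S P (mkpath u tau n).
Proof.
move=> ok l /mapP[k]; rewrite mem_iota /= add0n => kn ->; exact: ok.
Qed.

Lemma labelled_ex u n : (forall k, (k < n)%N -> d (u k) (u k.+1) = 1%N) ->
  exists tau, labelled u tau n.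
Proof.
move=> u1.
suff /choice[tau taup] : forall k, exists t, (k < n)%N ->
  letter_ok t ((u k)^-1 * u k.+1) by exists tau.
move=> k; have [kn|nk] := boolP (k < n)%N; last by exists None.
have n1 : (u k)^-1 * u k.+1 <> 1.
  move=> e; have := u1 k kn; have -> : u k.+1 = u k; last by rewrite cdistxx.
  by rewrite -[LHS](mulVKg (u k)) e mulg1.
have : (d (u k) (u k.+1) <= 1)%N by rewrite u1.
case/cdist1 => [e|[Sx|[i _ Pi]]]; first by case: n1; rewrite -e mulVg.
  by exists None.
by exists (Some i).
Qed.

Lemma labelled_set u tau n k i : labelled u tau n -> P i ((u k)^-1 * u k.+1) ->
  labelled u (fun j => if j == k then Some i else tau j) n.
Proof.
by move=> ok Pi j jn; have := ok j jn; case: (eqVneq j k) => [->|//] [].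
Qed.

(** Implies that there is no backtracking and that every component is an edge. *)
Definition spread u (tau : nat -> option 'I_m) n := forall c c' k,
  (c < n)%N -> (c' < n)%N -> c <> c' -> tau c <> None -> tau c' <> None ->
  P k ((u c)^-1 * u c.+1) -> P k ((u c)^-1 * u c') ->
  P k ((u c)^-1 * u c'.+1) -> False.

Lemma connected_edges (p q : cpath G m) s t :
  connected_components P p (s, s.+1) q (t, t.+1) ->
  exists i, [/\ P i ((cp_vertex p s)^-1 * cp_vertex p s.+1),
    P i ((cp_vertex p s)^-1 * cp_vertex q t) &
    P i ((cp_vertex p s)^-1 * cp_vertex q t.+1)].
Proof.
move=> [i [x [/= Cs Ct]]]; exists i.
have H a b : lcoset_set x (P i) a -> lcoset_set x (P i) b -> P i (a^-1 * b).
  move=> /lcoset_setP Pa /lcoset_setP Pb.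
  by have := subgroupM (rhf_subgroup P i) (subgroupV (rhf_subgroup P i) Pa) Pb; gsimp.
by split; apply: H; (apply: Cs || apply: Ct); rewrite leqnn leqnSn.
Qed.

Section Spread.

Context (u : nat -> G) (tau : nat -> option 'I_m) (n : nat).
Context (ok : labelled u tau n) (sp : spread u tau n).

Lemma spread_subpath i s : is_peripheral_subpath i (mkpath u tau n) s ->
  [/\ s.2 = s.1.+1, (s.1 < n)%N & tau s.1 = Some i].
Proof.
case; rewrite cp_len_mkpath => s12 tags.
have tg k : (s.1 <= k < s.2)%N -> tau k = Some i.
  by move=> ks; rewrite -(tags k ks) cp_tag_mkpath //; lia.
split; [|by lia|by apply: tg; lia].
apply/eqP/negPn/negP => s12'.
have t1 : tau s.1 = Some i by apply: tg; lia.
have t2 : tau s.1.+1 = Some i by apply: tg; lia.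
have h1 : (s.1 < n)%N by lia.
have h2 : (s.1.+1 < n)%N by lia.
have [_] := ok h1; rewrite t1 => P1; have [_] := ok h2; rewrite t2 => P2.
apply: (sp h1 h2 (@n_Sn _) _ _ P1 P1); rewrite ?t1 ?t2 //.
by have := subgroupM (rhf_subgroup P i) P1 P2; rewrite mulgA mulgK.
Qed.

Lemma spread_component s : is_component (mkpath u tau n) s ->
  [/\ s.2 = s.1.+1, (s.1 < n)%N & tau s.1 <> None].
Proof.
by case=> i [/spread_subpath[h1 h2 h3] _]; split; rewrite // h3.
Qed.

Lemma spread_edge_component k i : (k < n)%N -> tau k = Some i ->
  is_component (mkpath u tau n) (k, k.+1).
Proof.
move=> kn tk; exists i; split.
  split; first by rewrite cp_len_mkpath /= ltnSn.
  move=> j /= jk; have -> : j = k by lia.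
  by rewrite cp_tag_mkpath.
by case=> a b /= ak kb /spread_subpath [/= eb _ _]; congr pair; lia.
Qed.

Lemma spread_without_backtracking : without_backtracking P (mkpath u tau n).
Proof.
move=> [s1 s2] [t1 t2] /spread_component [/= -> sn ts].
move=> /spread_component [/= -> tn tt] /connected_edges [i [P1 P2 P3]].
rewrite !cp_vertex_mkpath // in P1 P2 P3; try exact: ltnW.
have [->//|/eqP st] := eqVneq s1 t1.
by case: (sp sn tn st ts tt P1 P2 P3).
Qed.

Lemma spread_phase k : (k <= n)%N -> is_phase (mkpath u tau n) k.
Proof.
move=> kn; split; first by rewrite cp_len_mkpath.
by move=> s /spread_component[-> _ _]; lia.
Qed.

End Spread.

Lemma geod_spread u tau n : geod u n -> spread u tau n.
Proof.
move=> ug c c' k cn c'n cc' _ _ P1 P2 P3.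
have H a b : P k ((u c)^-1 * u a) -> P k ((u c)^-1 * u b) -> P k ((u a)^-1 * u b).
  move=> Pa Pb.
  by have := subgroupM (rhf_subgroup P k) (subgroupV (rhf_subgroup P k) Pa) Pb; gsimp.
have [lt|ge] := ltnP c c'.
  by have := geod_lcoset ug _ P3; lia.
by have := geod_lcoset ug _ (H _ _ P2 P1); lia.
Qed.

Lemma geod_is_quasi_geodesic u tau n : labelled u tau n -> geod u n ->
  is_quasi_geodesic S P 1%R (0%R : R) (mkpath u tau n).
Proof.
move=> ok ug; split; first exact: mkpath_is_cpath.
move=> a b; rewrite cp_len_mkpath => abn.
by rewrite !cp_vertex_mkpath; [|lia..]; rewrite ug // mul1r addr0.
Qed.

Lemma short_is_quasi_geodesic u tau n L : labelled u tau n -> (n <= L)%N ->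
  is_quasi_geodesic S P 1%R (L%:R : R) (mkpath u tau n).
Proof.
move=> ok nL; split; first exact: mkpath_is_cpath.
move=> a b; rewrite cp_len_mkpath => abn.
by rewrite mul1r -natrD ler_nat; lia.
Qed.

Lemma mkpath_similar u tau n u' tau' n' k :
  (wlen S ((u 0%N)^-1 * u' 0%N) <= k)%N -> (wlen S ((u n)^-1 * u' n') <= k)%N ->
  Defs.similar S (k%:R : R) (mkpath u tau n) (mkpath u' tau' n').
Proof.
move=> h0 hn; rewrite /Defs.similar ler_nat geq_max /cp_end !cp_len_mkpath.
by rewrite !cp_vertex_mkpath // !wlen_dist h0.
Qed.

(** A path of length at most [L] is a quasi-geodesic with constants that depend on [L] only, so
    coset penetration compares it with the single edge between its ends. The constant [L.+1] covers
    that edge too when [L] is 0. *)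
Lemma BCP_short L : exists eps, forall u tau n k,
  labelled u tau n -> spread u tau n -> (n <= L)%N ->
  P k ((u 0%N)^-1 * u n) -> (eps < wlen S ((u 0%N)^-1 * u n))%N ->
  exists k' j, [/\ (j < n)%N, tau j <> None, P k' ((u 0%N)^-1 * u n),
    P k' ((u 0%N)^-1 * u j) & P k' ((u 0%N)^-1 * u j.+1)].
Proof.
have [||| eps _ bcpL] := (rhf_hyperbolic P).2 1%R (L.+1)%:R%R 0%R.
- by [].
- exact: ler0n.
- by [].
exists eps => u tau n k ok sp nL Puk big.
pose v j := if j == 0%N then u 0%N else u n.
have okv : labelled v (fun=> Some k) 1.
  move=> [|//] _; split=> //= e.
  by move: big; rewrite /v /= in e *; rewrite e wlen1.
have spv : spread v (fun=> Some k) 1 by move=> [|//] [|//].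
have [||||| _ + _] := bcpL (mkpath v (fun=> Some k) 1) (mkpath u tau n).
- exact: short_is_quasi_geodesic.
- by apply: short_is_quasi_geodesic => //; apply: leqW.
- exact: spread_without_backtracking.
- exact: spread_without_backtracking.
- by apply: (@mkpath_similar _ _ _ _ _ _ 0); rewrite /v /= mulVg wlen1.
move=> /(_ (0%N, 1%N)) /=; rewrite !cp_vertex_mkpath // wlen_dist => /(_ _ big).
case; first exact: (spread_edge_component okv spv (k := 0%N) (i := k)).
move=> [t1 t2] /(spread_component ok sp) [/= -> tn tt].
move=> /connected_edges [i [P1 P2 P3]]; exists i, t1.
by rewrite !cp_vertex_mkpath // in P1 P2 P3; exact: ltnW.
Qed.

(** All vertices of a geodesic are phase, which gives the first part. For the second, the long edge
    is given the tag [k], so that it is a component; this is why [main] leaves the labelling of [u]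
    free. *)
Lemma BCP_geod kap : exists eps, forall u n u' n',
  geod u n -> geod u' n' ->
  (wlen S ((u 0%N)^-1 * u' 0%N) <= kap)%N -> (wlen S ((u n)^-1 * u' n') <= kap)%N ->
  (forall i, (i <= n)%N -> exists2 j, (j <= n')%N &
     (wlen S ((u i)^-1 * u' j) <= eps)%N) /\
  (forall i k, (i < n)%N -> P k ((u i)^-1 * u i.+1) ->
     (eps < wlen S ((u i)^-1 * u i.+1))%N ->
     exists k' j, [/\ (j <= n')%N, P k' ((u i)^-1 * u i.+1) &
       P k' ((u i)^-1 * u' j)]).
Proof.
have [||| eps _ bcpL] := (rhf_hyperbolic P).2 1%R 0%R kap%:R%R.
- by [].
- by [].
- exact: ler0n.
exists eps => u n u' n' ug ug' h0 hn.
have step v l : geod v l -> exists tau, labelled v tau l.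
  by move=> vg; apply: labelled_ex => k kl; rewrite vg; lia.
have [tau ok] := step _ _ ug; have [tau' ok'] := step _ _ ug'.
have main tau1 : labelled u tau1 n -> 
  [/\ phase_near S eps (mkpath u tau1 n) (mkpath u' tau' n')
      /\ phase_near S eps (mkpath u' tau' n') (mkpath u tau1 n),
      forall s, is_component (mkpath u tau1 n) s ->
        (eps < word_dist S (cp_vertex (mkpath u tau1 n) s.1)
                          (cp_vertex (mkpath u tau1 n) s.2))%N ->
        exists2 t, is_component (mkpath u' tau' n') t &
          connected_components P (mkpath u tau1 n) s (mkpath u' tau' n') t & True].
  move=> ok1; have [||||| h1 h2 _] := bcpL (mkpath u tau1 n) (mkpath u' tau' n') => //.
  - exact: geod_is_quasi_geodesic.
  - exact: geod_is_quasi_geodesic.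
  - by apply: spread_without_backtracking => //; apply: geod_spread.
  - by apply: spread_without_backtracking => //; apply: geod_spread.
  - exact: mkpath_similar.
split.
  move=> i le; have [[near _] _ _] := main _ ok.
  have [|j [jl _]] := near i.
    by apply: spread_phase => //; apply: geod_spread.
  move: jl; rewrite cp_len_mkpath => jl.
  by rewrite !cp_vertex_mkpath // wlen_dist; exists j.
move=> i k le Pk big.
have ok1 := labelled_set ok Pk.
have sp1 := geod_spread (tau := fun j => if j == i then Some k else tau j) ug.
have sp' := geod_spread (tau := tau') ug'.
have [_ + _] := main _ ok1.
move=> /(_ (i, i.+1)) /=; rewrite !cp_vertex_mkpath //; last exact: ltnW.
rewrite wlen_dist => /(_ _ big).
case; first by apply: (spread_edge_component ok1 sp1 (i := k)); rewrite ?eqxx.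
move=> [t1 t2] /(spread_component ok' sp') [/= -> tn tt].
move=> /connected_edges [i' [P1 P2 _]]; exists i', t1.
by rewrite !cp_vertex_mkpath // in P1 P2; try exact: ltnW; split=> //; exact: ltnW.
Qed.

Lemma geod_labelled_ex u n : geod u n -> exists tau, labelled u tau n.
Proof. by move=> ug; apply: labelled_ex => k kn; rewrite ug; lia. Qed.

Lemma mkpath_geodesic u tau n : labelled u tau n -> geod u n ->
  is_geodesic S P (mkpath u tau n) (u 0%N) (u n).
Proof.
move=> ok ug; split=> //; first exact: mkpath_is_cpath.
  by rewrite /cp_end cp_len_mkpath cp_vertex_mkpath.
by rewrite cp_len_mkpath ug ?subn0 ?leqnn.
Qed.

Lemma slim_triangles : exists D, forall u n v l w r,
  geod u n -> geod v l -> geod w r -> u 0%N = w 0%N -> u n = v 0%N -> v l = w r ->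
  forall a, (a <= n)%N ->
  (exists2 b, (b <= l)%N & (d (u a) (v b) <= D)%N) \/
  (exists2 b, (b <= r)%N & (d (u a) (w b) <= D)%N).
Proof.
have [[delta delta0 hyp] _] := rhf_hyperbolic P; exists (Num.bound delta).
have bound x y : ((d x y)%:R <= delta)%R -> (d x y <= Num.bound delta)%N.
  move=> h; rewrite -(@ler_nat R).
  by apply: le_trans h _; apply/ltW/archi_boundP.
move=> u n v l w r ug vg wg uw uv vw a an.
have [tu oku] := geod_labelled_ex ug; have [tv okv] := geod_labelled_ex vg.
have [tw okw] := geod_labelled_ex wg.
have pu := mkpath_geodesic oku ug; have pv := mkpath_geodesic okv vg.
have pw := mkpath_geodesic okw wg.
rewrite -uv in pv; rewrite -uw -vw in pw.
have := hyp _ _ _ _ _ _ pu pv pw a; rewrite !cp_len_mkpath => /(_ an).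
case=> -[b bl]; rewrite !cp_vertex_mkpath // => /bound h.
  by left; exists b.
by right; exists b.
Qed.

End Geodesics.

(** * Maximal parabolic subgroups *)

Section Parabolics.

Context (R : realType) (G : groupType) (S : fin_gen_set G) (m : nat).
Context (P : rel_hyp_family R S m).

Local Notation cov := (cov S).
Local Notation unbounded := (unbounded S).
Local Notation wlen := (wlen S).

(** Coset penetration for the edge from [1] to a long [x] of the intersection and the
    path with label [f], [f^-1 * x * f], [f^-1], whose only peripheral edge is the
    middle one. *)
Lemma unboundedI_mem i k f : unbounded (P i `&` conj_set f (P k)) ->
  exists j, P j f.
Proof.
move=> unb.
have [v [v0 vn vg]] := word_dist_geodesic S 1 f.
set n0 := word_dist S 1 f in vn vg.
have vS t : (t < n0)%N -> (v t)^-1 * v t.+1 <> 1 /\ (S : set G) ((v t)^-1 * v t.+1).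
  move=> tn; have d1 : word_dist S (v t) (v t.+1) = 1%N by rewrite vg; lia.
  have n1 : v t <> v t.+1 by move=> e; rewrite e word_distxx in d1.
  split; first by move=> e; apply: n1; rewrite -[RHS](mulVKg (v t)) e mulg1.
  have : (word_dist S (v t) (v t.+1) <= 1)%N by rewrite d1.
  by case/word_dist1.
have [eps Heps] := BCP_short P (2 * n0).+1.
have [x [Pix /conj_setP Pkx] big] := unb eps.
pose u t := if (t <= n0)%N then v t else x * v (2 * n0 + 1 - t)%N.
pose tau t := if t == n0 then Some k else None.
have un : u (2 * n0).+1 = x.
  by rewrite /u addn1 subnn v0 mulg1 ifF //; lia.
have u0 : u 0%N = 1 by rewrite /u leq0n v0.
have x1 : x <> 1 by move=> e; rewrite e wlen1 in big.
have un0 : u n0 = f by rewrite /u leqnn vn.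
have [|||||k' [j [_ + _]]] := Heps u tau (2 * n0).+1 i.
- move=> t tn; rewrite /u /tau /letter_ok.
  have [lt|gt|->] := ltngtP t n0.
  + exact: vS.
  + have h : (2 * n0 + 1 - t.+1 < n0)%N by lia.
    have -> : (2 * n0 + 1 - t = (2 * n0 + 1 - t.+1).+1)%N by lia.
    have [n1 Ss] := vS _ h.
    have -> : (x * v (2 * n0 + 1 - t.+1).+1)^-1 * (x * v (2 * n0 + 1 - t.+1)%N) =
      ((v (2 * n0 + 1 - t.+1)%N)^-1 * v (2 * n0 + 1 - t.+1).+1)^-1 by gsimp.
    split; last exact: sgs_symmetric.
    by move=> e; apply: n1; rewrite -[LHS]invgK e invg1.
  + have -> : (2 * n0 + 1 - n0.+1 = n0)%N by lia.
    rewrite vn; move: Pkx; gsimp => Pkx; split=> // e; apply: x1.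
    have : f * (f^-1 * x * f) * f^-1 = 1 by rewrite e; gsimp.
    by gsimp.
- move=> c c' k0 _ _ cc'; rewrite /tau; case: eqP => [ec _|_ /(_ erefl)//].
  by case: eqP => [ec'|_ /(_ erefl)//]; case: cc'; rewrite ec ec'.
- by [].
- by rewrite u0 un invg1 mul1g.
- by rewrite u0 un invg1 mul1g.
rewrite {1}/tau; case: eqP => [->|_ /(_ erefl)//] _; rewrite u0 un0 invg1 mul1g => Pf _.
by exists k'.
Qed.

Lemma cover_mem A f Js Ks : is_subgroup A ->
  (forall a, A a -> exists2 j, j \in Js ++ Ks & P j (a * f)) ->
  (forall k, k \in Ks -> ~ cov A (P k)) ->
  exists j, [/\ j \in Js, cov A (P j) & P j f].
Proof.
elim: Js A Ks => [|j Js IH] A Ks HA cover nKs.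
  have [|k kKs Ak] := @neumann _ S _ P Ks A (wlen f) HA (rhf_subgroup P);
    last by case: (nKs k kKs).
  move=> a /cover[k kKs Pk]; exists k, (a * f); split=> //.
  by rewrite -wlenV //; gsimp.
have [Aj|nAj] := pselect (cov A (P j)); last first.
  have [||j' [j'Js Aj' Pj']] := IH A (j :: Ks) HA.
  - move=> a /cover[k kJ Pk]; exists k => //; move: kJ; rewrite !mem_cat !in_cons.
    by case: (k == j); case: (k \in Js).
  - by move=> k; rewrite in_cons => /orP[/eqP ->|/nKs].
  by exists j'; split=> //; rewrite in_cons j'Js orbT.
have [Pjf|nPjf] := pselect (P j f); first by exists j; rewrite mem_head.
have AAj := cov_subgroupI HA (rhf_subgroup P j) Aj.
have [||| j' [j'Js Aj' Pj']] := IH (A `&` P j) Ks.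
- exact: subgroupI HA (rhf_subgroup P j).
- move=> a [Aa Pja]; have [k + Pk] := cover a Aa.
  rewrite /= in_cons => /orP[/eqP ek|kJ]; last by exists k.
  by case: nPjf; rewrite ek in Pk; apply/(subgroupMl f (rhf_subgroup P j) Pja).
- by move=> k kKs Ak; apply: (nKs k kKs); apply: cov_trans AAj Ak.
exists j'; split=> //; first by rewrite in_cons j'Js orbT.
by apply: cov_trans AAj Aj'.
Qed.

(** The hypothesis passes from [f] to all [a * f * b] with [a] in [P i] and [b] in [P k], so all of
    these lie in peripheral subgroups. [cover_mem] first removes [a], then [b] (after inversion),
    keeping only indices that contain [P i] coarsely. *)
Lemma unboundedI_common i k f : unbounded (P i `&` conj_set f (P k)) ->
  exists j, [/\ cov (P i) (P j), cov (P k) (P j) & P j f].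
Proof.
move=> unb.
have inP a b : P i a -> P k b -> exists j, P j (a * f * b).
  move=> Pa Pb; apply: (@unboundedI_mem i k).
  apply: unbounded_sub (unbounded_conj a unb).
  move=> _ [x [Pix /conj_setP Pkx] <-]; split.
    by apply: subgroupM (subgroupM _ Pa Pix) (subgroupV _ Pa); apply: rhf_subgroup.
  apply/conj_setP; have := subgroupM (rhf_subgroup P k)
    (subgroupM (rhf_subgroup P k) (subgroupV (rhf_subgroup P k) Pb) Pkx) Pb; by gsimp.
have step1 b : P k b -> exists j, cov (P i) (P j) /\ P j (f * b).
  move=> Pb.
  have [a Pa|//|j [_ ? ?]] := @cover_mem _ (f * b) (enum 'I_m) [::] (rhf_subgroup P i).
    have [j Pj] := inP a b Pa Pb; exists j; last by rewrite mulgA.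
    by rewrite cats0 mem_enum.
  by exists j.
have [b Pb|//|j [jJ ? Pj]] := @cover_mem _ f^-1
    [seq j <- enum 'I_m | `[< cov (P i) (P j) >]] [::] (rhf_subgroup P k).
  have [j [ij Pj]] := step1 _ (subgroupV (rhf_subgroup P k) Pb); exists j.
    by rewrite cats0 mem_filter mem_enum andbT; apply/asboolP.
  by have := subgroupV (rhf_subgroup P j) Pj; gsimp.
move: jJ; rewrite mem_filter => /andP[/asboolP ij _]; exists j; split=> //.
by have := subgroupV (rhf_subgroup P j) Pj; gsimp.
Qed.

(** Maximality is for the preorder [cov], since different indices may give commensurable
    subgroups. *)
Definition maximal_parabolic M :=
  unbounded (P M) /\ forall j, cov (P M) (P j) -> cov (P j) (P M).

Lemma maximal_parabolic_ex i : unbounded (P i) ->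
  exists2 M, maximal_parabolic M & cov (P i) (P M).
Proof.
move=> unb.
(* Among the indices coarsely above [i], one with the most indices coarsely below it is maximal. *)
pose down M := [set j | `[< cov (P j) (P M) >]]%SET.
have iup : `[< cov (P i) (P i) >] by apply/asboolP; exact: cov_refl.
case: (@arg_maxnP _ i (fun M => `[< cov (P i) (P M) >]) (fun M => #|down M|) iup)
  => M /asboolP iM maxM.
exists M => //; split=> [|j Mj]; first exact: unbounded_cov unb iM.
have ij : `[< cov (P i) (P j) >] by apply/asboolP; apply: cov_trans iM Mj.
have sub : down M \subset down j.
  apply/fintype.subsetP => l; rewrite !inE => lM.
  exact: cov_trans lM Mj.
have /eqP e : down M == down j by rewrite eqEcard sub; apply: maxM.
have : j \in down j by rewrite !inE; exact: cov_refl.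
by rewrite -e !inE.
Qed.

(** The maximal parabolic subgroup commensurable to [P M]. *)
Definition hull M : set G := [set x | exists2 j, cov (P M) (P j) & P j x].

Lemma hullP M f : unbounded (P M `&` conj_set f (P M)) -> hull M f.
Proof. by move=> /unboundedI_common[j [Mj _ Pf]]; exists j. Qed.

Lemma hull_cov_lcoset M f : maximal_parabolic M -> hull M f ->
  cov (P M) (lcoset_set f (P M)).
Proof.
move=> [_ maxM] [j Mj Pjf]; apply: (cov_trans Mj).
apply: (@cov_subl _ _ _ (lcoset_set f (P j))).
  move=> x Pjx; apply/lcoset_setP.
  by apply: subgroupM (subgroupV _ Pjf) Pjx; apply: rhf_subgroup.
by apply: cov_lcoset; apply: maxM.
Qed.

(** This union of subgroups is closed under products because it is a commensurator: it consists of
    the [f] for which [P M] and [f P M f^-1] have infinite intersection, by [hullP] and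
    [hull_cov_lcoset]. *)
Lemma hull_subgroup M : maximal_parabolic M -> is_subgroup (hull M).
Proof.
move=> HM; have [unb maxM] := HM; split.
  by exists M; [exact: cov_refl|exact: subgroup1 (rhf_subgroup P M)].
move=> f g Hf [j Mj Pjg]; apply: hullP => //.
have Hg : hull M g^-1 by exists j => //; apply: subgroupV Pjg; apply: rhf_subgroup.
apply: (unbounded_coarseI (rhf_subgroup P M)
  (subgroup_conj _ (rhf_subgroup P M)) unb (@cov_refl _ S _)).
apply: (cov_trans _ (cov_lcoset_conj S _ _)).
apply: (cov_trans (hull_cov_lcoset HM Hf)).
have := cov_lcoset f (hull_cov_lcoset HM Hg).
apply: cov_subr => _ [_ [x Px <-] <-]; exists x => //.
by rewrite mulgA.
Qed.

Lemma parabolic_sub_hull M i : maximal_parabolic M -> unbounded (P i) ->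
  cov (P i) (P M) -> P i `<=` hull M.
Proof.
move=> HM unb iM f Pif; apply: hullP => //.
apply: (unbounded_coarseI (rhf_subgroup P M)
  (subgroup_conj _ (rhf_subgroup P M)) unb iM).
apply: (cov_trans _ (cov_lcoset_conj S _ _)).
apply: (@cov_subl _ _ _ (lcoset_set f (P i))).
  move=> x Pix; apply/lcoset_setP.
  by apply: subgroupM (subgroupV _ Pif) Pix; apply: rhf_subgroup.
exact: cov_lcoset.
Qed.

Lemma hull_cov M : maximal_parabolic M -> cov (hull M) (P M).
Proof.
move=> [_ maxM].
have [|||n Hn] := @uniform_bound 'I_m setT (fun j n => cov (P M) (P j) ->
   forall a, P j a -> exists2 b, P M b & (wlen (b^-1 * a) <= n)%N).
- exact: finite_finset.
- move=> j n k nk Hn Mj a Pa; have [b Pb bn] := Hn Mj a Pa.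
  by exists b => //; apply: leq_trans nk.
- move=> j _; have [/maxM[n Hn]|no] := pselect (cov (P M) (P j)); first by exists n.
  by exists 0%N.
by exists n => a [j Mj Pja]; apply: (Hn j).
Qed.

Lemma unbounded_bigcup (I : finType) (A : I -> set G) :
  unbounded (\bigcup_i A i) -> exists i, unbounded (A i).
Proof.
move=> unb; apply: contrapT => no.
have [|||n Hn] := @uniform_bound I setT (fun i n => forall a, A i a -> (wlen a <= n)%N).
- exact: finite_finset.
- by move=> i n k nk Hn a /Hn an; apply: leq_trans nk.
- move=> i _; have /existsNP[n nA] := (forallNP _).2 no i; exists n => a Aa.
  by rewrite leqNgt; apply/negP => an; apply: nA; exists a.
by have [a [i _ Aa]] := unb n; rewrite ltnNge (Hn i).
Qed.

(** Some [P j] in the finite union [hull M] has infinite intersection with [P k]; a common coarse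
    upper bound of the two is coarsely below [P M] by maximality. *)
Lemma unbounded_hullI M k : maximal_parabolic M -> unbounded (hull M `&` P k) ->
  [/\ unbounded (P k), cov (P k) (P M) & P k `<=` hull M].
Proof.
move=> HM unb; have [_ maxM] := HM.
have uk : unbounded (P k) by apply: unbounded_sub unb => x [].
suff kM : cov (P k) (P M) by split=> //; apply: parabolic_sub_hull.
have [|j] := @unbounded_bigcup 'I_m (fun j => [set x | cov (P M) (P j) /\ (P j `&` P k) x]).
  by apply: unbounded_sub unb => x [[j Mj Pj] Pk]; exists j.
move=> uj; have Mj : cov (P M) (P j) by have [x []] := uj 0%N.
have [|l [jl kl _]] := @unboundedI_common j k 1.
  apply: unbounded_sub uj => x [_ [Pj Pk]]; split=> //.
  by apply/conj_setP; gsimp.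
by apply: cov_trans kl _ => //; apply: maxM; apply: cov_trans Mj jl.
Qed.

Lemma hull_long : exists N, forall M k x, maximal_parabolic M -> hull M x -> P k x ->
  (N < wlen x)%N -> [/\ unbounded (P k), cov (P k) (P M) & P k `<=` hull M].
Proof.
have [|||N HN] := @uniform_bound ('I_m * 'I_m)%type setT (fun p N => forall x,
  maximal_parabolic p.1 -> hull p.1 x -> P p.2 x ->
  (N < wlen x)%N -> [/\ unbounded (P p.2), cov (P p.2) (P p.1) & P p.2 `<=` hull p.1]).
- exact: finite_finset.
- by move=> p n k nk Hn x HM hx Px kx; apply: Hn hx Px _ => //; apply: leq_ltn_trans kx.
- move=> [M k] _ /=.
  have [/existsNP[n Hn]|unb] := pselect (~ unbounded (hull M `&` P k)).
    by exists n => x _ hx Px nx; case: Hn; exists x.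
  by exists 0%N => x HM *; apply: unbounded_hullI => //; apply: contrapT.
by exists N => M k x HM hx Px; apply: (HN (M, k)).
Qed.

Lemma hull_alphabet M x : hull M x -> exists i, P i x.
Proof. by case=> j _; exists j. Qed.

(** A long common element lies in some [P k] that is coarsely below both [P M] and [P M']. These
    then have a common coarse upper bound, and by maximality they are coarsely equal. *)
Lemma hullI_long : exists N, forall M M' x, maximal_parabolic M ->
  maximal_parabolic M' -> hull M x -> hull M' x -> (N < wlen x)%N ->
  hull M = hull M'.
Proof.
have [N HN] := hull_long; exists N => M M' x HM HM' hx hx' Nx.
have [k Pkx] := hull_alphabet hx.
have [uk kM _] := HN M k x HM hx Pkx Nx; have [_ kM' _] := HN M' k x HM' hx' Pkx Nx.
have [|l [Ml M'l _]] := @unboundedI_common M M' 1.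
  have := unbounded_coarseI (rhf_subgroup P M)
    (rhf_subgroup P M') uk kM kM'.
  by apply: unbounded_sub => y [? ?]; split=> //; apply/conj_setP; gsimp.
have MM' : cov (P M) (P M') by apply: cov_trans Ml (HM'.2 _ M'l).
have M'M : cov (P M') (P M) by apply: cov_trans M'l (HM.2 _ Ml).
by apply/seteqP; split=> y [j Mj Pj]; exists j => //; apply: cov_trans Mj.
Qed.

End Parabolics.

(** * Separating short elements from a subgroup *)

Section Separation.

Context (G : groupType) (S : fin_gen_set G).

Local Notation cov := (cov S).
Local Notation wlen := (wlen S).

Lemma cov_seqI (T : eqType) (A : set G) (B : T -> set G) (s : seq T) :
  is_subgroup A -> (forall t, is_subgroup (B t)) -> (forall t, cov A (B t)) ->
  cov A (A `&` [set x | forall t, t \in s -> B t x]) /\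
  is_subgroup (A `&` [set x | forall t, t \in s -> B t x]).
Proof.
move=> HA HB covB.
have sub (s' : seq T) : is_subgroup (A `&` [set x | forall t, t \in s' -> B t x]).
  apply: subgroupI => //; split=> [t _|x y Bx By t ts]; first exact: subgroup1 (HB t).
  by apply: (HB t).2; [apply: Bx|apply: By].
split=> //; elim: s => [|t s IH]; first by apply: cov_sub => x Ax; split.
have st : cov (A `&` [set x | forall t, t \in s -> B t x]) (B t).
  by apply: cov_subl (covB t) => x [].
have st' := cov_trans IH (cov_subgroupI (sub s) (HB t) st).
apply: cov_subr st' => x [[Ax Bx] Btx]; split=> // t'; rewrite in_cons => /orP[/eqP ->//|].
by apply: Bx.
Qed.

Lemma separable_finite_index (K L : set G) y : is_subgroup K -> is_subgroup L ->
  L `<=` K -> separable_in K L -> K y -> ~ L y ->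
  exists B, [/\ is_subgroup B, L `<=` B, cov K B & ~ B y].
Proof.
move=> HK HL LK sep Ky nLy; have [F [pi [piM piK nLpi]]] := sep y Ky nLy.
have pi1 : pi 1 = 1.
  have := piM 1 1 (subgroup1 HK) (subgroup1 HK); rewrite mulg1 => e.
  by apply: (mulgI (pi 1)); rewrite -e mulg1.
have piV x : K x -> pi x^-1 = (pi x)^-1.
  move=> Kx; apply: (mulgI (pi x)).
  by rewrite -piM ?mulgV ?pi1 //; apply: subgroupV.
(* The preimage of the image of [L]; the fibres of [pi] over the finite quotient bound its index in
   [K]. *)
pose B := [set x | K x /\ (pi @` L) (pi x)].
have HB : is_subgroup B.
  split; first by split; [exact: subgroup1|exists 1 => //; exact: subgroup1].
  move=> a b [Ka [l Ll el]] [Kb [l' Ll' el']]; split; first exact: HK.2.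
  exists (l * l'^-1); first exact: HL.2.
  by rewrite !piM ?piV ?el ?el' //; auto; apply: subgroupV; auto.
exists B; split=> //; last by case=> _ [l Ll el]; apply: nLpi; exists l.
  by move=> l Ll; split; [exact: LK|exists l].
have [|||n Hn] := @uniform_bound F setT (fun v n => forall a, K a -> pi a = v ->
   exists2 b, B b & (wlen (b^-1 * a) <= n)%N).
- exact: finite_finset.
- move=> v n k nk Hn a Ka av; have [b Bb bn] := Hn a Ka av.
  by exists b => //; apply: leq_trans nk.
- move=> v _; have [[c [Kc cv]]|no] := pselect (exists c, K c /\ pi c = v).
    exists (wlen c) => a Ka av; exists (a * c^-1); last by gsimp.
    split; first exact: HK.2.
    by exists 1; [exact: subgroup1|rewrite piM ?piV // ?av ?cv ?mulgV //; exact: subgroupV].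
  by exists 0%N => a Ka av; case: no; exists a.
by exists n => a Ka; apply: (Hn (pi a)).
Qed.

(** Slenderness makes [L] finitely generated, hence separable. A finite-index subgroup excluding [y]
    is chosen for each [y], and those of the finitely many [y] in the ball are intersected. *)
Lemma LERF_avoid_ball (K L : set G) C : is_subgroup K -> slender K -> LERF K ->
  is_subgroup L -> L `<=` K ->
  exists B, [/\ is_subgroup B, L `<=` B, B `<=` K, cov K B &
    forall x, B x -> ~ L x -> (C < wlen x)%N].
Proof.
move=> HK sK lK HL LK; have sep := lK L HL LK (sK L HL LK).
have /choice[B HB] : forall y, exists B,
    [/\ is_subgroup B, L `<=` B, cov K B & K y -> ~ L y -> ~ B y].
  move=> y; have [[Ky nLy]|no] := pselect (K y /\ ~ L y).
    by have [B [? ? ? ?]] := separable_finite_index HK HL LK sep Ky nLy; exists B.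
  by exists setT; split=> //; [apply: cov_sub|move=> Ky nLy; case: no].
have /finite_seqP[s es] := finite_wlen_ball S C.
have [||covI subI] := @cov_seqI _ K B s HK.
- by move=> t; case: (HB t).
- by move=> t; case: (HB t).
exists (K `&` [set x | forall t, t \in s -> B t x]); split=> //.
- by move=> l Ll; split; [exact: LK|move=> t _; have [_ LB _ _] := HB t; apply: LB].
move=> x [Kx Bx] nLx; rewrite ltnNge; apply/negP => xC.
have xs : x \in s by have : [set x | (wlen x <= C)%N] x by []; rewrite es.
by have [_ _ _] := HB x; apply => //; apply: Bx.
Qed.

(** A finite-index overgroup of a slender LERF group is LERF: [R] is [L] times
    the intersection of the [L]-conjugates of a finite-index subgroup of [K]. *)
Lemma LERF_overgroup_avoid_ball (E K L : set G) C :
  is_subgroup E -> is_subgroup K -> K `<=` E -> cov E K -> slender K -> LERF K ->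
  is_subgroup L -> L `<=` E ->
  exists B, [/\ is_subgroup B, L `<=` B, B `<=` E, cov E B &
    forall x, B x -> ~ L x -> (C < wlen x)%N].
Proof.
move=> HE HK KE EK sK lK HL LE.
have [n Hn] : cov L (L `&` K) by apply: cov_subgroupI => //; apply: cov_subl EK.
have {}Hn l : L l -> exists l0 c, [/\ L l0, (wlen l0 <= n)%N, L c, K c & l = l0 * c].
  move=> Ll; have [c [Lc Kc] cn] := Hn _ (subgroupV HL Ll).
  exists (l * c), c^-1; split; last by gsimp.
  - exact: subgroupM HL Ll Lc.
  - by rewrite -wlenV invgM.
  - exact: subgroupV HL Lc.
  - exact: subgroupV HK Kc.
have [R' [HR' LR' R'K KR' avoid]] := LERF_avoid_ball (C + n) HK sK lK
  (subgroupI HL HK) (@subIsetr _ L K).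
pose B t := [set x | L t -> conj_set t R' x].
have HB t : is_subgroup (B t).
  have HtR := subgroup_conj t HR'; split=> [Lt|x y Bx By Lt]; first exact: subgroup1.
  by apply: HtR.2; [apply: Bx|apply: By].
have covB t : cov E (B t).
  have [Lt|nLt] := pselect (L t); last by apply: cov_sub => x _ /nLt.
  apply: (@cov_subl _ _ _ (lcoset_set t E)).
    move=> x Ex; apply/lcoset_setP; exact: subgroupM HE (subgroupV HE (LE t Lt)) Ex.
  have := cov_trans (cov_lcoset t (cov_trans EK KR')) (cov_lcoset_conj S t R').
  by apply: cov_subr => x Rx _.
have /finite_seqP[s es] := finite_wlen_ball S n.
have [covI _] := cov_seqI s HE HB covB.
exists [set x | E x /\ exists2 l, L l &
  forall l', L l' -> R' (l'^-1 * (l^-1 * x) * l')]; split.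
- split.
    split; first exact: subgroup1.
    exists 1; first exact: subgroup1.
    by move=> l' Ll'; gsimp; apply: subgroup1.
  move=> x y [Ex [l Ll Hl]] [Ey [k Lk Hk]]; split; first exact: HE.2.
  exists (l * k^-1); first exact: HL.2.
  move=> l' Ll'; have Lkl' : L (k^-1 * l') := subgroupM HL (subgroupV HL Lk) Ll'.
  have := HR'.2 _ _ (Hl _ Lkl') (Hk _ Lkl'); by gsimp.
- move=> l Ll; split; first exact: LE.
  by exists l => // l' Ll'; gsimp; apply: subgroup1.
- by move=> x [].
- apply: cov_subr covI => x [Ex Ix]; split=> //; exists 1; first exact: subgroup1.
  (* Since [c] lies in [R'], the conjugates of [R'] by [l'] and by the short [l0] agree; so finitely
     many conjugates suffice. *)
  move=> l' Ll'; have [l0 [c [Ll0 l0n Lc Kc ->]]] := Hn l' Ll'.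
  have l0s : l0 \in s by have : [set x | (wlen x <= n)%N] l0 by []; rewrite es.
  have /conj_setP R'x := Ix l0 l0s Ll0; have R'c : R' c by apply: LR'.
  have := subgroupM HR' (subgroupM HR' (subgroupV HR' R'c) R'x) R'c; by gsimp.
move=> x [Ex [l Ll Hl]] nLx; rewrite ltnNge; apply/negP => xC.
have R'lx : R' (l^-1 * x) by have := Hl 1 (subgroup1 HL); gsimp.
have [l0 [c [Ll0 l0n Lc Kc el]]] := Hn l Ll.
(* This element has length at most [C + n], the radius chosen for [R'], so it lies in [L], and then
   so does [x]. *)
have R'y : R' (l0^-1 * x).
  have := subgroupM HR' (LR' c (conj Lc Kc)) R'lx; by rewrite el; gsimp.
have := avoid _ R'y; rewrite ltnNge => h; have /h/negP[] : ~ (L `&` K) (l0^-1 * x).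
  by case=> Ly _; apply: nLx; have := subgroupM HL Ll0 Ly; rewrite mulVKg.
by apply: leq_trans (wlenM S _ _) _; rewrite wlenV addnC; apply: leq_add.
Qed.

End Separation.

(** * Projections to parabolic cosets *)

Section Projections.

Context (R : realType) (G : groupType) (S : fin_gen_set G) (m : nat).
Context (P : rel_hyp_family R S m).

Local Notation wlen := (wlen S).
Local Notation d := (cayley_dist S P).
Local Notation geod := (geod P).

Definition is_coset (Y : set G) :=
  exists M f, maximal_parabolic P M /\ Y = lcoset_set f (hull P M).

Lemma coset_hull Y x : is_coset Y -> Y x ->
  exists2 M, maximal_parabolic P M & Y = lcoset_set x (hull P M).
Proof.
move=> [M [f [HM ->]]] Yx; exists M => //.
exact: lcoset_set_eq (hull_subgroup HM) Yx.
Qed.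

Lemma lcoset_coset g Y : is_coset Y -> is_coset (lcoset_set g Y).
Proof.
move=> [M [f [HM ->]]]; exists M, (g * f); split=> //.
by apply/seteqP; split=> x /lcoset_setP; [move=> /lcoset_setP h|move=> h;
  apply/lcoset_setP]; apply/lcoset_setP; move: h; gsimp.
Qed.

Lemma coset_dist Y x y : is_coset Y -> Y x -> Y y -> (d x y <= 1)%N.
Proof.
move=> HY Yx Yy; have [M HM eY] := coset_hull HY Yx.
have /lcoset_setP /hull_alphabet[i] : lcoset_set x (hull P M) y by rewrite -eY.
exact: cdist_P.
Qed.

Lemma coset_alphabet Y x y : is_coset Y -> Y x -> Y y -> exists i, P i (x^-1 * y).
Proof.
move=> HY Yx Yy; have [M HM eY] := coset_hull HY Yx.
by have /lcoset_setP /hull_alphabet : lcoset_set x (hull P M) y by rewrite -eY.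
Qed.

(** Coset penetration yields cosets of some [P k] with [k] out of control; for long edges this shows
    that they stay inside [Y]. *)
Lemma coset_long : exists N, forall Y x y k z, is_coset Y -> Y x -> Y y ->
  P k (x^-1 * y) -> (N < wlen (x^-1 * y))%N -> P k (x^-1 * z) -> Y z.
Proof.
have [N HN] := hull_long P; exists N => Y x y k z HY Yx Yy Pxy Nxy Pxz.
have [M HM eY] := coset_hull HY Yx.
have /lcoset_setP hxy : lcoset_set x (hull P M) y by rewrite -eY.
have [_ _ sub] := HN M k _ HM hxy Pxy Nxy.
by rewrite eY; apply/lcoset_setP/sub.
Qed.

Lemma coset_inter : exists N, forall Y Y' x y, is_coset Y -> is_coset Y' ->
  Y x -> Y y -> Y' x -> Y' y -> (N < wlen (x^-1 * y))%N -> Y = Y'.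
Proof.
have [N HN] := hullI_long P; exists N => Y Y' x y HY HY' Yx Yy Y'x Y'y Nxy.
have [M HM eY] := coset_hull HY Yx; have [M' HM' eY'] := coset_hull HY' Y'x.
rewrite eY eY' (HN M M' (x^-1 * y)) //; apply/lcoset_setP.
  by rewrite -eY.
by rewrite -eY'.
Qed.

(** [1 < n] excludes the direct edge, which joins points of a coset that are arbitrarily far apart
    for [S]. *)
Definition detour (Y : set G) z z' u n := [/\ (1 < n)%N, u 0%N = z, u n = z',
  forall k, (k < n)%N -> (d (u k) (u k.+1) <= 1)%N &
  forall k, (0 < k < n)%N -> ~ Y (u k)].

Lemma detour_shortcut Y z z' u n a b : detour Y z z' u n -> (a < b <= n)%N ->
  (d (u a) (u b) <= 1)%N -> ~ (a = 0%N /\ b = n) ->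
  exists u', detour Y z z' u' (a + (n - b)).+1.
Proof.
move=> [n1 u0 un u1 uY] abn dab ab0.
exists (fun t => if (t <= a)%N then u t else u (t + b - a.+1)%N); split.
- by lia.
- by [].
- rewrite ifF; last by lia.
  by have -> : ((a + (n - b)).+1 + b - a.+1 = n)%N by lia.
- move=> k kn; have [ka|ak|->] := ltngtP k a.
  + by rewrite u1 //; lia.
  + have -> : (k.+1 + b - a.+1 = (k + b - a.+1).+1)%N by lia.
    by apply: u1; lia.
  + by have -> : (a.+1 + b - a.+1 = b)%N by lia.
move=> k kn; case: leqP => ka; apply: uY; lia.
Qed.

(** A shortest path between two points of a coset that avoids the coset in
    between has no backtracking, so that coset penetration applies to it. *)
Lemma detour_bound L : exists B, forall Y z z' u n, is_coset Y -> Y z -> Y z' ->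
  detour Y z z' u n -> (n <= L)%N -> (wlen (z^-1 * z') <= B)%N.
Proof.
have [eps Heps] := BCP_short P L; have [N HN] := coset_long.
exists (maxn eps N) => Y z z' u0 n0 HY Yz Yz' det0 n0L.
rewrite leqNgt; apply/negP; rewrite gtn_max => /andP[big bigN].
pose Q n := `[< exists u, detour Y z z' u n >].
have exQ : exists n, Q n by exists n0; apply/asboolP; exists u0.
case: (ex_minnP exQ) => n /asboolP[u det] nmin.
have nL : (n <= L)%N by apply: leq_trans n0L; apply: nmin; apply/asboolP; exists u0.
have [n1 u0z unz u1 uY] := det.
have short a b : (a < b <= n)%N -> (d (u a) (u b) <= 1)%N ->
    (b = a.+1)%N \/ (a = 0%N /\ b = n).
  move=> abn dab; have [ab0|ab0] := pselect (a = 0%N /\ b = n); first by right.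
  have [u' det'] := detour_shortcut det abn dab ab0.
  have : (n <= (a + (n - b)).+1)%N by apply: nmin; apply/asboolP; exists u'.
  by left; lia.
have inY y k : P k (z^-1 * z') -> P k (z^-1 * y) -> Y y.
  by move=> Pzz' Pzy; apply: (HN Y z z' k).
have step k : (k < n)%N -> d (u k) (u k.+1) = 1%N.
  move=> kn; apply/eqP; rewrite eqn_leq u1 // lt0n; apply/negP => /eqP /cdist0 e.
  have [k0|k0] := posnP k.
    by apply: (uY 1%N); [lia|rewrite -[1%N]/(0.+1)%N -k0 -e k0 u0z].
  have [kn1|kn1] := eqVneq k.+1 n.
    by apply: (uY k); [lia|rewrite e kn1 unz].
  have [||e1|[e1 e2]] := short k.-1 k.+1.
  - by lia.
  - by rewrite -e -{2}(prednK k0); apply: u1; lia.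
  - by lia.
  - by lia.
have [tau ok] := labelled_ex step.
have sp : spread P u tau n.
  move=> c c' k cn c'n cc' _ _ P1 P2 P3.
  have Pc a b : P k ((u c)^-1 * u a) -> P k ((u c)^-1 * u b) -> P k ((u a)^-1 * u b).
    move=> Pa Pb; have := subgroupM (rhf_subgroup P k)
      (subgroupV (rhf_subgroup P k) Pa) Pb; by gsimp.
  have far a b : (a.+1 < b <= n)%N -> P k ((u a)^-1 * u b) ->
      P k ((u a)^-1 * u a.+1) -> False.
    move=> abn Pab Pa1; have [||ab|[ea eb]] := short a b.
    - by lia.
    - exact: cdist_P Pab.
    - by lia.
    rewrite ea eb u0z unz in Pab Pa1.
    by apply: (uY 1%N); [lia|exact: inY Pab Pa1].
  have [lt|gt] := ltnP c c'; first by apply: (far c c'.+1) => //; lia.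
  by apply: (far c' c.+1); [lia|apply: Pc|apply: Pc].
have [k Pzz'] := coset_alphabet HY Yz Yz'.
rewrite -u0z -unz in Pzz' big.
have [k' [j [jn _ P1 P2 P3]]] := Heps u tau n k ok sp nL Pzz' big.
rewrite u0z unz in P1 P2 P3.
(* Both ends of the edge found by coset penetration lie in [Y], and as [1 < n] one of them is an
   interior vertex. *)
have [j0|j0] := posnP j.
  by apply: (uY j.+1); [lia|exact: inY P1 P3].
by apply: (uY j); [lia|exact: inY P1 P2].
Qed.

Definition reach (Y : set G) n x y := exists u, [/\ u 0%N = x, u n = y,
  forall k, (k < n)%N -> (d (u k) (u k.+1) <= 1)%N &
  forall k, (k <= n)%N -> ~ Y (u k)].

Lemma reach_dist Y n x y : reach Y n x y -> (d x y <= n)%N.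
Proof.
by move=> [u [<- <- u1 _]]; have := path_cdist u1 (i := 0%N) (j := n); rewrite subn0;
  apply; rewrite leqnn.
Qed.

Lemma reach_sym Y n x y : reach Y n x y -> reach Y n y x.
Proof.
move=> [u [u0 un u1 uY]]; exists (fun k => u (n - k)%N); split.
- by rewrite subn0.
- by rewrite subnn.
- move=> k kn; rewrite cdistC.
  have -> : (n - k = (n - k.+1).+1)%N by lia.
  by apply: u1; lia.
by move=> k kn; apply: uY; lia.
Qed.

Lemma reach_trans Y n k y x z : reach Y n x y -> reach Y k y z -> reach Y (n + k) x z.
Proof.
move=> [u [u0 un u1 uY]] [v [v0 vk v1 vY]].
exists (fun t => if (t <= n)%N then u t else v (t - n)%N); split.
- by [].
- case: leqP => h; last by rewrite addKn.
  have k0 : k = 0%N by lia.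
  by rewrite k0 addn0 un -v0 -vk k0.
- move=> t; case: (ltngtP t n) => [tn|nt|->] tnk.
  + exact: u1.
  + have -> : (t.+1 - n = (t - n).+1)%N by lia.
    by apply: v1; lia.
  + have -> : (n.+1 - n = 1)%N by lia.
    by rewrite un -v0; apply: v1; lia.
by move=> t tnk; case: leqP => tn; [apply: uY|apply: vY; lia].
Qed.

Lemma reach_geod Y u n i j : geod u n -> (i <= j <= n)%N ->
  (forall k, (i <= k <= j)%N -> ~ Y (u k)) -> reach Y (j - i) (u i) (u j).
Proof.
move=> ug ijn uY; exists (fun k => u (i + k)%N); split.
- by rewrite addn0.
- by rewrite subnKC //; lia.
- by move=> k kn; rewrite ug; lia.
by move=> k kn; apply: uY; lia.
Qed.

Lemma reach_detour Y n z a b z' : (d z a <= 1)%N -> reach Y n a b ->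
  (d b z' <= 1)%N -> exists u, detour Y z z' u n.+2.
Proof.
move=> za [v [v0 vn v1 vY]] bz'.
exists (fun t => if t is t'.+1 then if (t' <= n)%N then v t' else z' else z); split.
- by [].
- by [].
- by rewrite ltnn.
- move=> [|k] kn; first by rewrite leq0n v0.
  have [lt|gt|->] := ltngtP k n; [exact: v1|lia|by rewrite vn].
by move=> [|k] kn; [lia|rewrite ifT; [apply: vY|]; lia].
Qed.

(** The entrance points of geodesics from [x] to the coset [Y] play the role of
    the projections of [x] to [Y]. *)
Definition entrance (Y : set G) x z := Y z /\ exists u n,
  [/\ geod u n, u 0%N = x, u n = z & forall k, (k < n)%N -> ~ Y (u k)].

Lemma entrance_mem Y x z : Y x -> entrance Y x z -> z = x.
Proof.
move=> Yx [_ [u [[|n] [_ u0 un uY]]]]; first by rewrite -u0.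
by case: (uY 0%N); rewrite ?u0.
Qed.

Lemma entrance_first Y u n i : geod u n -> (i <= n)%N -> Y (u i) ->
  exists j, [/\ (j <= i)%N, Y (u j) & entrance Y (u 0%N) (u j)].
Proof.
move=> ug le Yi.
have exQ : exists k, `[< Y (u k) >] by exists i; apply/asboolP.
case: (ex_minnP exQ) => j /asboolP Yj jmin; exists j.
have ji : (j <= i)%N by apply: jmin; apply/asboolP.
split=> //; split=> //; exists u, j; split=> //.
  by move=> a b abj; apply: ug; lia.
by move=> k kj Yk; have := jmin k; rewrite leqNgt kj; move/(_ (introT (asboolP _) Yk)).
Qed.

Lemma entrance_last Y u n i : geod u n -> (i <= n)%N -> Y (u i) ->
  exists j, [/\ (i <= j <= n)%N, Y (u j) & entrance Y (u n) (u j)].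
Proof.
move=> ug le Yi; have := @entrance_first Y _ n (n - i)%N (geod_rev ug).
rewrite leq_subr subKn // => /(_ isT Yi) [j [ji Yj ent]]; exists (n - j)%N.
by rewrite subn0 in ent; split=> //; lia.
Qed.

Lemma entrance_ex Y x : is_coset Y -> exists z, entrance Y x z.
Proof.
move=> HY; have [y Yy] : exists y, Y y.
  have [M [f [HM ->]]] := HY; exists f; apply/lcoset_setP; rewrite mulVg.
  exact: subgroup1 (hull_subgroup HM).
have [u [n [ug u0 un]]] := geod_ex P x y.
rewrite -un in Yy; have [j [_ _ ent]] := entrance_first ug (leqnn n) Yy.
by exists (u j); rewrite -u0.
Qed.

Lemma entrance_lcoset g Y x z : entrance Y x z ->
  entrance (lcoset_set g Y) (g * x) (g * z).
Proof.
move=> [Yz [u [n [ug u0 un uY]]]]; split; first by exists z.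
exists (fun k => g * u k), n; split; rewrite ?u0 ?un //.
  by move=> i j ijn; rewrite cdistMl; apply: ug.
by move=> k kn /lcoset_setP; rewrite mulKg; apply: uY.
Qed.

(** The quadrilateral [x], [z], [z'], [y] is cut along a diagonal into two slim triangles. As [Y]
    has diameter at most 1, the point at distance [t = 2 * D + 2] from [z] is more than [2 * D] away
    from [Y]. So slimness joins it to [c] or [v], by a geodesic too short to meet [Y]. *)
Lemma geodesic_side : exists T, forall Y z z' x y u n1 v n2 c lc,
  is_coset Y -> Y z -> Y z' ->
  geod u n1 -> u 0%N = z -> u n1 = x -> (forall k, (0 < k <= n1)%N -> ~ Y (u k)) ->
  geod v n2 -> v 0%N = z' -> v n2 = y -> (forall k, (0 < k <= n2)%N -> ~ Y (v k)) ->
  geod c lc -> c 0%N = x -> c lc = y -> (forall k, (k <= lc)%N -> ~ Y (c k)) ->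
  (0 < n1)%N /\
  ((exists b n, [/\ (b <= lc)%N, (n <= T)%N & reach Y n (u 1%N) (c b)]) \/
   (exists k n, [/\ (0 < k <= n2)%N, (k <= T)%N, (n <= T)%N &
      reach Y n (u 1%N) (v k)])).
Proof.
have [D slim] := slim_triangles P; pose t := (2 * D + 2)%N.
exists (t + 2 * D + 2)%N.
move=> Y z z' x y u n1 v n2 c lc HY Yz Yz' ug u0 un uY vg v0 vn vY cg c0 cn cY.
have n1_gt0 : (0 < n1)%N.
  by rewrite lt0n; apply/eqP => e; apply: (cY 0%N) => //; rewrite c0 -un e u0.
split=> //; have [n1t|n1t] := leqP n1 t.
  left; exists 0%N, (n1 - 1)%N; split=> //; first by lia.
  by rewrite c0 -un; apply: reach_geod ug _ _ => [|k kn]; [lia|apply: uY; lia].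
have farY w : Y w -> (2 * D < d (u t) w)%N.
  move=> Yw; have := cdist_triangle P w z (u t); have := coset_dist HY Yz Yw.
  by rewrite -{2}u0 ug ?(cdistC P w); lia.
have bridge q : (d (u t) q <= 2 * D)%N -> reach Y (d (u t) q) (u t) q.
  move=> dq; have [w [l [wg w0 wl]]] := geod_ex P (u t) q.
  have el : d (u t) q = l by rewrite -w0 -wl wg ?subn0 ?leqnn.
  have := @reach_geod Y w l 0%N l wg; rewrite subn0 w0 wl el; apply; first by lia.
  by move=> k kl /farY; rewrite -w0 wg; lia.
have ru : reach Y (t - 1) (u 1%N) (u t).
  by apply: reach_geod ug _ _ => [|k kt]; [lia|apply: uY; lia].
have [w [lw [wg w0 wl]]] := geod_ex P z y.
have [e [le [eg e0 el]]] := geod_ex P z z'.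
have le1 : (le <= 1)%N.
  by have := coset_dist HY Yz Yz'; rewrite -e0 -el eg ?subn0 ?leqnn.
have [||||[b blc db]|[b bl db]] := slim u n1 c lc w lw ug cg wg _ _ _ t.
- by rewrite u0 w0.
- by rewrite un c0.
- by rewrite cn wl.
- exact: ltnW.
- left; exists b, (t - 1 + d (u t) (c b))%N; split=> //; first by lia.
  by apply: reach_trans ru (bridge _ _); lia.
have [|||[k kn dk]|[k kl dk]] :=
    slim w lw (fun k => v (n2 - k)%N) n2 e le wg (geod_rev vg) eg _ _ _ b bl.
- by rewrite w0 e0.
- by rewrite wl subn0 vn.
- by rewrite subnn v0 el.
- have dq : (d (u t) (v (n2 - k)%N) <= 2 * D)%N.
    by apply: leq_trans (cdist_triangle P (w b) _ _) _; lia.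
  have rq := bridge _ dq.
  have k0 : (0 < n2 - k)%N.
    rewrite lt0n; apply/eqP => e1; move: rq; rewrite e1 v0 => -[q [_ q1 _ qY]].
    by apply: (qY _ (leqnn _)); rewrite q1.
  right; exists (n2 - k)%N, (t - 1 + d (u t) (v (n2 - k)%N))%N; split; [lia| |lia|].
    have dv : d z' (v (n2 - k)%N) = (n2 - k)%N by rewrite -{1}v0 vg; lia.
    have du : d z (u t) = t by rewrite -{1}u0 ug; lia.
    have := cdist_triangle P z z' (v (n2 - k)%N).
    have := cdist_triangle P (u t) z (v (n2 - k)%N).
    by have := coset_dist HY Yz' Yz; lia.
  exact: reach_trans ru rq.
have : Y (e k).
  have [->|->] : k = 0%N \/ k = le by lia.
    by rewrite e0.
  by rewrite el.
move=> /farY.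
by have := cdist_triangle P (w b) (u t) (e k); lia.
Qed.

(** [geodesic_side] is applied at [z] and at [z']. If one of the two sides is joined to the other, a
    piece of that side completes a detour; if both are joined to [c], the piece of [c] in between is
    short and avoids [Y]. Then [detour_bound] applies. *)
Lemma avoid_bound : exists B, forall Y x y z z' c lc, is_coset Y ->
  entrance Y x z -> entrance Y y z' -> geod c lc -> c 0%N = x -> c lc = y ->
  (forall k, (k <= lc)%N -> ~ Y (c k)) -> (wlen (z^-1 * z') <= B)%N.
Proof.
have [T side] := geodesic_side; have [B HB] := detour_bound (6 * T + 10).
exists B => Y x y z z' c lc HY [Yz [u [n1 [ug u0 un uY]]]] [Yz' [v [n2 [vg v0 vn vY]]]].
move=> cg c0 cn cY.
have uY' k : (0 < k <= n1)%N -> ~ Y (u (n1 - k)%N) by move=> kn; apply: uY; lia.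
have vY' k : (0 < k <= n2)%N -> ~ Y (v (n2 - k)%N) by move=> kn; apply: vY; lia.
have u0' : u (n1 - 0)%N = z by rewrite subn0.
have v0' : v (n2 - 0)%N = z' by rewrite subn0.
have un' : u (n1 - n1)%N = x by rewrite subnn.
have vn' : v (n2 - n2)%N = y by rewrite subnn.
have c0' : c (lc - 0)%N = y by rewrite subn0.
have cn' : c (lc - lc)%N = x by rewrite subnn.
have cY' k : (k <= lc)%N -> ~ Y (c (lc - k)%N) by move=> kn; apply: cY; lia.
have [n1_gt0 s1] := side Y z z' x y _ n1 _ n2 c lc HY Yz Yz' (geod_rev ug) u0' un' uY'
  (geod_rev vg) v0' vn' vY' cg c0 cn cY.
have [n2_gt0 s2] := side Y z' z y x _ n2 _ n1 _ lc HY Yz' Yz (geod_rev vg) v0' vn' vY'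
  (geod_rev ug) u0' un' uY' (geod_rev cg) c0' cn' cY'.
have zu : (d z (u (n1 - 1)%N) <= 1)%N by rewrite cdistC -un ug; lia.
have zv : (d (v (n2 - 1)%N) z' <= 1)%N by rewrite -vn vg; lia.
have fin n : (n <= 6 * T + 8)%N -> reach Y n (u (n1 - 1)%N) (v (n2 - 1)%N) ->
    (wlen (z^-1 * z') <= B)%N.
  move=> nT r; have [w det] := reach_detour zu r zv.
  by apply: HB det _ => //; lia.
case: s1 => [[b [n [blc nT r]]]|[k [n [kn kT nT r]]]]; last first.
  apply: (fin (n + (n2 - 1 - (n2 - k)))%N); first by lia.
  apply: reach_trans r _; apply: reach_sym.
  apply/reach_sym; apply: reach_geod vg _ _; first by lia.
  by move=> j jk; apply: vY; lia.
case: s2 => [[b' [n' [blc' nT' r']]]|[k [n' [kn kT nT' r']]]]; last first.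
  apply: (fin ((n1 - 1 - (n1 - k)) + n')%N); first by lia.
  apply: reach_trans _ (reach_sym r'); apply: reach_sym.
  apply: reach_geod ug _ _; first by lia.
  by move=> j jk; apply: uY; lia.
have dcc : (d (c b) (c (lc - b')%N) <= 2 * T + 3)%N.
  have h1 := reach_dist (reach_sym r); have h2 := reach_dist r'.
  have h3 : (d (u (n1 - 1)%N) z <= 1)%N by rewrite cdistC.
  have h4 : (d z' (v (n2 - 1)%N) <= 1)%N by rewrite cdistC.
  have := cdist_triangle P (u (n1 - 1)%N) (c b) (c (lc - b')%N).
  have := cdist_triangle P (v (n2 - 1)%N) (u (n1 - 1)%N) (c (lc - b')%N).
  have := cdist_triangle P z (u (n1 - 1)%N) (v (n2 - 1)%N).
  have := cdist_triangle P z' z (v (n2 - 1)%N).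
  by have := coset_dist HY Yz Yz'; lia.
have [j jT rc] : exists2 j, (j <= 2 * T + 3)%N & reach Y j (c b) (c (lc - b')%N).
  have [le|gt] := leqP b (lc - b').
    exists (lc - b' - b)%N; first by rewrite cg in dcc; lia.
    by apply: reach_geod cg _ _ => [|k kb]; [lia|apply: cY; lia].
  exists (b - (lc - b'))%N; first by rewrite cdistC cg in dcc; lia.
  by apply: reach_sym; apply: reach_geod cg _ _ => [|k kb]; [lia|apply: cY; lia].
apply: (fin (n + j + n')%N); first by lia.
exact: reach_trans (reach_trans r rc) (reach_sym r').
Qed.

Lemma entrance_unique : exists B, forall Y x z z', is_coset Y ->
  entrance Y x z -> entrance Y x z' -> (wlen (z^-1 * z') <= B)%N.
Proof.
have [B HB] := avoid_bound; exists B => Y x z z' HY ez ez'.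
have [Yx|nYx] := pselect (Y x).
  by rewrite (entrance_mem Yx ez) (entrance_mem Yx ez') mulVg wlen1.
apply: (HB Y x x z z' (fun=> x) 0%N) => //.
by move=> i j ij; rewrite cdistxx; lia.
Qed.

(** A geodesic from [x] to [x'] has no other vertices. If both avoid [Y'], this is [avoid_bound]; if
    both are in [Y'], [coset_inter] applies; if only one is, it is an entrance point for the other
    as well. *)
Lemma entrance_coset_bound : exists B, forall Y Y' x x' z z', is_coset Y ->
  is_coset Y' -> Y <> Y' -> Y x -> Y x' -> entrance Y' x z -> entrance Y' x' z' ->
  (wlen (z^-1 * z') <= B)%N.
Proof.
have [B1 HB1] := avoid_bound; have [B2 HB2] := entrance_unique.
have [N HN] := coset_inter; exists (maxn B1 (maxn B2 N)).
move=> Y Y' x x' z z' HY HY' YY' Yx Yx' ez ez'; rewrite !leq_max.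
have [c [lc [cg c0 cn]]] := geod_ex P x x'.
have lc1 : (lc <= 1)%N.
  by have := coset_dist HY Yx Yx'; rewrite -c0 -cn cg ?subn0 ?leqnn.
have ends k : (k <= lc)%N -> k = 0%N \/ k = lc by lia.
have one a b w w' : Y a -> Y b -> Y' a -> ~ Y' b -> entrance Y' a w ->
    entrance Y' b w' -> (wlen (w^-1 * w') <= B2)%N.
  move=> Ya Yb Y'a nY'b ew ew'; apply: (HB2 Y' b) => //.
  have [v [l [vg v0 vl]]] := geod_ex P b a.
  have l1 : (l <= 1)%N.
    by have := coset_dist HY Yb Ya; rewrite -v0 -vl vg ?subn0 ?leqnn.
  rewrite (entrance_mem Y'a ew); split=> //; exists v, l; split=> //.
  move=> k kl; have -> : k = 0%N by lia.
  by rewrite v0.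
have [Y'x|nY'x] := pselect (Y' x); have [Y'x'|nY'x'] := pselect (Y' x').
- rewrite (entrance_mem Y'x ez) (entrance_mem Y'x' ez'); apply/orP; right; apply/orP.
  by right; rewrite leqNgt; apply/negP => /(HN Y Y' x x' HY HY' Yx Yx' Y'x Y'x').
- by apply/orP; right; apply/orP; left; apply: one ez ez'.
- apply/orP; right; apply/orP; left; rewrite wlenC.
  exact: one Yx' Yx Y'x' nY'x ez' ez.
apply/orP; left; apply: (HB1 Y' x x' z z' c lc) => // k /ends[->|->].
  by rewrite c0.
by rewrite cn.
Qed.

End Projections.

(** * Combination of [Q] with subgroups of parabolic stabilizers *)

Section Combination.

Context (R : realType) (G : groupType) (S : fin_gen_set G) (m : nat).
Context (P : rel_hyp_family R S m) (Q : set G) (HQ : is_subgroup Q).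

Local Notation wlen := (wlen S).
Local Notation d := (cayley_dist S P).
Local Notation geod := (geod P).

Definition near_coset K g x := exists2 q, Q q & (wlen ((g * q)^-1 * x) <= K)%N.

Lemma near_cosetM K g q x : Q q -> near_coset K (g * q) x <-> near_coset K g x.
Proof.
move=> Qq; split=> -[q' Qq' le].
  by exists (q * q'); [exact: subgroupM HQ Qq Qq'|rewrite mulgA].
exists (q^-1 * q'); first exact: subgroupM HQ (subgroupV HQ Qq) Qq'.
by move: le; gsimp.
Qed.

Lemma near_coset_trans K K' g x y : near_coset K g x ->
  (wlen (x^-1 * y) <= K')%N -> near_coset (K + K') g y.
Proof.
move=> [q Qq le] xy; exists q => //.
by apply: leq_trans (wlen_triangle S x _ _) _; apply: leq_add.
Qed.

Lemma near_coset_le K K' g x : (K <= K')%N -> near_coset K g x -> near_coset K' g x.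
Proof. by move=> KK' [q Qq le]; exists q => //; apply: leq_trans KK'. Qed.

Lemma near_coset_mem K g q : Q q -> near_coset K g (g * q).
Proof. by move=> Qq; exists q => //; rewrite mulVg wlen1. Qed.

(** [(M, f)] stands for the coset [f E] of the maximal parabolic [E = hull P M],
    and for its stabilizer [f E f^-1]. *)
Definition pcoset (rho : 'I_m * G) := lcoset_set rho.2 (hull P rho.1).
Definition pstab (rho : 'I_m * G) := conj_set rho.2 (hull P rho.1).

Lemma pstab_subgroup rho : maximal_parabolic P rho.1 -> is_subgroup (pstab rho).
Proof. by move=> H; apply: subgroup_conj; apply: hull_subgroup. Qed.

Lemma pcoset_is_coset g rho : maximal_parabolic P rho.1 ->
  is_coset P (lcoset_set g (pcoset rho)).
Proof.
by move=> HM; apply: lcoset_coset; exists rho.1, rho.2.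
Qed.

Lemma lcoset_setM (g h : G) (A : set G) :
  lcoset_set (g * h) A = lcoset_set g (lcoset_set h A).
Proof.
apply/seteqP; split=> x /lcoset_setP.
  by move=> Ax; apply/lcoset_setP/lcoset_setP; move: Ax; gsimp.
by move=> /lcoset_setP Ax; apply/lcoset_setP; move: Ax; gsimp.
Qed.

Lemma lcoset_set1 (A : set G) : lcoset_set 1 A = A.
Proof.
by apply/seteqP; split=> x; [move/lcoset_setP|move=> h; apply/lcoset_setP];
  rewrite invg1 mul1g.
Qed.

Lemma lcoset_set_inj (g : G) : injective (lcoset_set g).
Proof.
by move=> A B /(congr1 (lcoset_set g^-1)); rewrite -!lcoset_setM mulVg !lcoset_set1.
Qed.

Lemma pstabP rho r : maximal_parabolic P rho.1 ->
  pstab rho r <-> lcoset_set r (pcoset rho) = pcoset rho.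
Proof.
move=> HM; have HE := hull_subgroup HM; split=> [/conj_setP Er|e].
  rewrite /pcoset -lcoset_setM; apply/esym/lcoset_set_eq => //.
  by apply/lcoset_setP; rewrite mulgA.
have : lcoset_set r (pcoset rho) (r * rho.2).
  by exists rho.2 => //; apply/lcoset_setP; rewrite mulVg; apply: subgroup1.
by rewrite e => /lcoset_setP; rewrite mulgA => h; apply/conj_setP.
Qed.

(** [B] is the projection constant and [C] the least size of the jump made by a letter of [N rho]
    outside [Q]. The factor 5 in [C_large] allows for a loss of [2 * B] at either end of a jump and
    leaves [B], enough to contradict [B_avoid]. *)
Context (sigma K B C : nat) (rep : 'I_m * G -> Prop) (N : 'I_m * G -> set G).
Context (Q_hull : forall g u n, geod u n -> near_coset sigma g (u 0%N) ->
  near_coset sigma g (u n) -> forall i, (i <= n)%N -> near_coset K g (u i)).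
Context (B_avoid : forall Y x y z z' c lc, is_coset P Y -> entrance P Y x z ->
  entrance P Y y z' -> geod c lc -> c 0%N = x -> c lc = y ->
  (forall k, (k <= lc)%N -> ~ Y (c k)) -> (wlen (z^-1 * z') <= B)%N).
Context (B_unique : forall Y x z z', is_coset P Y -> entrance P Y x z ->
  entrance P Y x z' -> (wlen (z^-1 * z') <= B)%N).
Context (B_coset : forall Y Y' x x' z z', is_coset P Y -> is_coset P Y' ->
  Y <> Y' -> Y x -> Y x' -> entrance P Y' x z -> entrance P Y' x' z' ->
  (wlen (z^-1 * z') <= B)%N).
Context (rep_maximal : forall rho, rep rho -> maximal_parabolic P rho.1).
Context (rep_short : forall rho, rep rho -> (wlen rho.2 <= sigma)%N).
Context (rep_unique : forall rho rho' q, rep rho -> rep rho' -> Q q ->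
  pcoset rho = lcoset_set q (pcoset rho') -> rho = rho').
Context (N_subgroup : forall rho, rep rho -> is_subgroup (N rho)).
Context (N_stab : forall rho, rep rho -> N rho `<=` pstab rho).
Context (N_Q : forall rho, rep rho -> Q `&` pstab rho `<=` N rho).
Context (N_far : forall rho r h x y, rep rho -> N rho r -> ~ Q r ->
  lcoset_set h (pcoset rho) x -> lcoset_set h (pcoset rho) y ->
  near_coset K h x -> near_coset K (h * r) y -> (C < wlen (x^-1 * y))%N).
Context (C_large : (5 * B <= C)%N).

(** A triple contributes the product of its outer entries, the middle one recording which [N rho]
    the second factor comes from. The final factor in [Q] is kept apart, as an argument of
    [eval]. *)
Definition word := seq (G * ('I_m * G) * G).

Fixpoint eval (w : word) (q' : G) : G :=
  if w is (q, rho, r) :: w then q * r * eval w q' else q'.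

Fixpoint admissible (w : word) : Prop :=
  if w is (q, rho, r) :: w then [/\ Q q, rep rho, N rho r & admissible w] else True.

Fixpoint reduced (w : word) : Prop :=
  if w is (q, rho, r) :: w then
    [/\ ~ Q r,
        (* Since [r] stabilizes [pcoset rho], this says that consecutive cosets crossed by the
           product differ. *)
        if w is (q', rho', _) :: _ then pcoset rho <> lcoset_set q' (pcoset rho')
        else True
      & reduced w]
  else True.

Definition amalgam : set G :=
  [set h | exists w q, [/\ admissible w, Q q & h = eval w q]].

Lemma absorb w q x : Q x -> admissible w -> Q q -> exists w' q',
  [/\ size w' = size w, admissible w', Q q' & eval w' q' = x * eval w q].
Proof.
move=> Qx; case: w => [|[[q1 rho] r] w] /=.
  by move=> _ Qq; exists [::], (x * q); split=> //; apply: subgroupM HQ Qx Qq.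
move=> [Qq1 Hrho Nr okw] Qq; exists ((x * q1, rho, r) :: w), q => /=; split=> //.
  by split=> //; apply: subgroupM HQ Qx Qq1.
by gsimp.
Qed.

Lemma amalgam_Ql x y : Q x -> amalgam y -> amalgam (x * y).
Proof.
move=> Qx [w [q [ok Qq ->]]]; have [w' [q' [_ ok' Qq' <-]]] := absorb Qx ok Qq.
by exists w', q'.
Qed.

Lemma amalgam_Nl rho r y : rep rho -> N rho r -> amalgam y -> amalgam (r * y).
Proof.
move=> Hrho Nr [w [q [ok Qq ->]]]; exists ((1, rho, r) :: w), q; split=> //=.
  by split=> //; apply: subgroup1.
by rewrite mul1g.
Qed.

Lemma sub_amalgam : Q `<=` amalgam.
Proof. by move=> q Qq; exists [::], q. Qed.

Lemma N_sub_amalgam rho : rep rho -> N rho `<=` amalgam.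
Proof.
move=> Hrho r Nr; rewrite -[r]mulg1; apply: (amalgam_Nl Hrho Nr).
exact: sub_amalgam (subgroup1 HQ).
Qed.

Lemma amalgamM x y : amalgam x -> amalgam y -> amalgam (x * y).
Proof.
move=> [w [q [ok Qq ->]]] Hy; elim: w ok => [|[[q1 rho] r] w IH] /=.
  by move=> _; apply: amalgam_Ql.
move=> [Qq1 Hrho Nr /IH h]; rewrite -!mulgA.
by apply: amalgam_Ql => //; apply: (amalgam_Nl Hrho Nr).
Qed.

Lemma amalgam_subgroup : is_subgroup amalgam.
Proof.
split; first exact: sub_amalgam (subgroup1 HQ).
move=> x y Hx Hy; apply: amalgamM => //; case: Hy => [w [q [ok Qq ->]]] {x Hx y}.
elim: w ok => [|[[q1 rho] r] w IH] /=.
  by move=> _; apply: sub_amalgam; apply: subgroupV.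
move=> [Qq1 Hrho Nr /IH h]; rewrite !invgM; apply: amalgamM => //.
apply: amalgamM; last by apply: sub_amalgam; apply: subgroupV HQ _.
by apply: (N_sub_amalgam Hrho); apply: subgroupV => //; apply: N_subgroup.
Qed.

(** A letter [r] in [Q] is absorbed by its neighbour. If two consecutive cosets coincide,
    [rep_unique] gives the same [rho], the letter [q2] between them stabilizes the coset and so lies
    in [N rho], and the factors [r], [q2], [r2] merge. *)
Lemma shorten w q : admissible w -> Q q -> reduced w \/ exists w' q',
  [/\ (size w' < size w)%N, admissible w', Q q' & eval w' q' = eval w q].
Proof.
move=> + Qq; elim: w => [|[[q1 rho] r] w IH] /=; first by left.
move=> [Qq1 Hrho Nr okw].
have [Qr|nQr] := pselect (Q r).
  have [w' [q' [sw' ok' Qq' ew']]] := absorb (subgroupM HQ Qq1 Qr) okw Qq.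
  by right; exists w', q'; rewrite sw'.
case: (IH okw) => [redw|[w' [q' [sw' ok' Qq' ew']]]]; last first.
  by right; exists ((q1, rho, r) :: w'), q'; split=> //=; rewrite ew'.
case: w {IH} okw redw => [|[[q2 rho2] r2] w] okw redw; first by left.
have [e|ne] := pselect (pcoset rho = lcoset_set q2 (pcoset rho2)); last by left.
right; move: okw => /= [Qq2 Hrho2 Nr2 okw].
have e2 := rep_unique Hrho Hrho2 Qq2 e; rewrite -e2 in e Nr2.
have Nq2 : N rho q2.
  by apply: N_Q => //; split=> //; apply/pstabP => //; apply: rep_maximal.
exists ((q1, rho, r * q2 * r2) :: w), q; split=> //=; last by gsimp.
have HN := N_subgroup Hrho.
by split=> //; apply: subgroupM HN (subgroupM HN Nr Nq2) Nr2.
Qed.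

Lemma amalgam_reduced h : amalgam h -> exists w q,
  [/\ admissible w, reduced w, Q q & h = eval w q].
Proof.
move=> [w [q [ok Qq ->]]]; have [n le] := ubnP (size w).
elim: n w q ok Qq le => // n IH w q ok Qq le.
have [red|[w' [q' [sw' ok' Qq' <-]]]] := shorten ok Qq; first by exists w, q.
by apply: IH => //; apply: leq_trans sw' _; rewrite -ltnS.
Qed.

(** * The cosets crossed by a reduced product *)

Section Step.

Context (g q : G) (rho : 'I_m * G) (r : G).
Context (Qq : Q q) (Hrho : rep rho) (Nr : N rho r).

Local Notation Y := (lcoset_set (g * q) (pcoset rho)).

Lemma step_is_coset : is_coset P Y.
Proof. by apply: pcoset_is_coset; apply: rep_maximal. Qed.

Lemma step_cosetE : Y = lcoset_set (g * q * r) (pcoset rho).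
Proof.
rewrite (lcoset_setM (g * q) r); congr lcoset_set; apply/esym/pstabP.
  exact: rep_maximal.
exact: N_stab Nr.
Qed.

Lemma pcoset_base : pcoset rho rho.2.
Proof.
apply/lcoset_setP; rewrite mulVg.
exact: subgroup1 (hull_subgroup (rep_maximal Hrho)).
Qed.

Lemma step_base : Y (g * q * rho.2) /\ near_coset sigma g (g * q * rho.2).
Proof.
split; first by exists rho.2 => //; apply: pcoset_base.
by exists q => //; rewrite mulKg; apply: rep_short.
Qed.

Lemma step_base_end :
  Y (g * q * r * rho.2) /\ near_coset sigma (g * q * r) (g * q * r * rho.2).
Proof.
split; first by rewrite step_cosetE; exists rho.2 => //; apply: pcoset_base.
by exists 1; [exact: subgroup1|rewrite mulg1 mulKg; apply: rep_short].
Qed.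

(** A geodesic from [x] to [u] follows the coset [h Q], so its first point on [Y] is an entrance
    near [h Q]; entrances of [x] differ by a bounded amount. *)
Lemma entrance_near h x u z : near_coset sigma h x -> near_coset sigma h u -> Y u ->
  entrance P Y x z ->
  exists s, [/\ Y s, near_coset K h s & (wlen (z^-1 * s) <= 2 * B)%N].
Proof.
move=> nx nu Yu ez; have [c [n [cg c0 cn]]] := geod_ex P x u.
rewrite -c0 in nx; rewrite -cn in nu Yu.
have [j [jn Yj]] := entrance_first cg (leqnn n) Yu; rewrite c0 => ej.
exists (c j); split=> //; first exact: Q_hull nx nu _ jn.
by apply: leq_trans (B_unique step_is_coset ez ej) _; lia.
Qed.

End Step.

Section TwoSteps.

Context (g q : G) (rho : 'I_m * G) (r q2 : G) (rho2 : 'I_m * G).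
Context (Qq : Q q) (Hrho : rep rho) (Nr : N rho r) (Qq2 : Q q2) (Hrho2 : rep rho2).
Context (neq : pcoset rho <> lcoset_set q2 (pcoset rho2)).

Local Notation Y1 := (lcoset_set (g * q) (pcoset rho)).
Local Notation Y2 := (lcoset_set (g * q * r * q2) (pcoset rho2)).

Lemma two_steps_neq : Y1 <> Y2.
Proof.
rewrite (step_cosetE g q Hrho Nr) (lcoset_setM (g * q * r)) => e; apply: neq.
exact: lcoset_set_inj e.
Qed.

(** A geodesic from [Y1] to [Y2] with ends near [g q r Q]; its last point on [Y1] and first point on
    [Y2] locate the projections of each coset to the other. *)
Lemma two_steps_bridge : exists u u' s s', [/\ Y1 u, Y2 u',
  Y1 s /\ Y2 s', entrance P Y1 u' s /\ near_coset K (g * q * r) s &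
  entrance P Y2 u s' /\ near_coset K (g * q * r) s'].
Proof.
have [Yu nu] := step_base_end g q Hrho Nr.
have [Yu' nu'] := step_base (g * q * r) Qq2 Hrho2.
have [c [n [cg c0 cn]]] := geod_ex P (g * q * r * rho.2) (g * q * r * q2 * rho2.2).
rewrite -c0 in Yu nu; rewrite -cn in Yu' nu'.
have [i [le Yi ei]] := entrance_last cg (leq0n n) Yu.
have [j [jn Yj ej]] := entrance_first cg (leqnn n) Yu'.
exists (c 0%N), (c n), (c i), (c j).
by split=> //; split=> //; apply: Q_hull nu nu' _ _.
Qed.

End TwoSteps.

(** Ping-pong. By induction the end of the product projects to the next coset [Y2] near the far side
    of its jump, whereas [Y1] projects near the close side. So a geodesic from the end to [Y2]
    cannot meet [Y1], and the end projects to [Y1] close to where [Y2] does. *)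
Lemma entrance_from_end w g q rho r q' z : admissible ((q, rho, r) :: w) ->
  reduced ((q, rho, r) :: w) -> Q q' ->
  entrance P (lcoset_set (g * q) (pcoset rho)) (g * eval ((q, rho, r) :: w) q') z ->
  exists s, [/\ lcoset_set (g * q) (pcoset rho) s, near_coset K (g * q * r) s &
    (wlen (z^-1 * s) <= 2 * B)%N].
Proof.
move=> ok red Qq'; elim: w g q rho r z ok red => [|[[q2 rho2] r2] w IH] g q rho r z.
  move=> [Qq Hrho Nr _] _ /=; rewrite !mulgA => ez.
  have [Yu nu] := step_base_end g q Hrho Nr.
  by apply: entrance_near nu Yu ez => //; apply: near_coset_mem.
move=> [Qq Hrho Nr [Qq2 Hrho2 Nr2 okw]] [nQr neq [nQr2 neq2 redw]].
set y := g * eval _ _; set Y1 := lcoset_set _ _ => ez.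
have [u [u' [s [s' [Yu Yu' [Ys Ys'] [es ns] [es' ns']]]]]] :=
  two_steps_bridge g q Hrho Nr Qq2 Hrho2.
have Y12 := @two_steps_neq g q rho r q2 rho2 Hrho Nr neq.
set Y2 := lcoset_set (g * q * r * q2) _ in Yu' Ys' es' Y12.
have HY1 : is_coset P Y1 by exact: step_is_coset.
have HY2 : is_coset P Y2 by exact: step_is_coset.
have [z2 ez2] := entrance_ex y HY2.
have [|||s2 [Ys2 ns2 zs2]] := IH (g * q * r) q2 rho2 r2 z2.
- by [].
- by [].
- by move: ez2; rewrite /y /= !mulgA.
have [Yz2 [v [l [vg v0 vl vY2]]]] := ez2.
have [[k [kl Yk]]|no] := pselect (exists k, (k <= l)%N /\ Y1 (v k)).
  have ek : entrance P Y2 (v k) z2.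
    split=> //; exists (fun i => v (k + i)%N), (l - k)%N; split.
    - by apply: geod_shift vg _; lia.
    - by rewrite addn0.
    - by rewrite subnKC.
    - by move=> i il; apply: vY2; lia.
  have h1 := B_coset HY1 HY2 Y12 Yk Yu ek es'.
  have h2 : (C < wlen (s'^-1 * s2))%N.
    apply: (N_far Hrho2 Nr2 nQr2 Ys' Ys2) => //.
    exact/near_cosetM.
  have := wlen_triangle S z2 s' s2; rewrite (wlenC S s' z2); len_lia.
have [z3 ez3] := entrance_ex z2 HY1.
exists s; split=> //; apply: leq_trans (wlen_triangle S z3 _ _) _.
rewrite mul2n -addnn; apply: leq_add.
  by apply: (B_avoid HY1 ez ez3 vg v0 vl) => k kl Yk; apply: no; exists k.
by apply: (B_coset HY2 HY1 _ Yz2 Yu' ez3 es) => e; apply: Y12.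
Qed.

(** * Geodesics between the ends of a reduced product *)

Let K' := (K + sigma + 2 * B)%N.

(** The [i]-th edge of [c] crosses a translate of a chosen coset in the first case,
    and belongs to a part of [c] that follows a coset of [Q] in the second. *)
Definition tame g (c : nat -> G) n i :=
  (exists h h' rho, [/\ amalgam (g^-1 * h) /\ amalgam (g^-1 * h'), rep rho,
    lcoset_set h (pcoset rho) (c i), lcoset_set h (pcoset rho) (c i.+1) &
    near_coset K' h (c i) /\ near_coset K' h' (c i.+1)]) \/
  (exists h a b, [/\ amalgam (g^-1 * h), (a <= i < b)%N, (b <= n)%N,
    near_coset K' h (c a) & near_coset K' h (c b)]).

(** Induction on the word, cutting [c] where it leaves the first coset [Y]. The remaining piece does
    not start in a coset of [Q], hence the assumption on the entrances of [c 0]. Before [Y] the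
    geodesic follows [g Q], and after it the induction hypothesis applies to [g * q * r]. *)
Lemma geodesic_tame w g q' c n : admissible w -> reduced w -> Q q' -> geod c n ->
  c n = g * eval w q' -> near_coset K' g (c 0%N) ->
  (if w is (q, rho, r) :: _ then
     forall z, entrance P (lcoset_set (g * q) (pcoset rho)) (c 0%N) z ->
     exists s, [/\ lcoset_set (g * q) (pcoset rho) s, near_coset K g s &
       (wlen (z^-1 * s) <= 2 * B)%N]
   else True) ->
  (forall i, (i < n)%N -> tame g c n i) /\
  (w <> [::] -> exists i j, [/\ (i <= n)%N, (j <= n)%N &
     (C < wlen ((c i)^-1 * c j) + 4 * B)%N]).
Proof.
move=> + + Qq'; elim: w g c n => [|[[q rho] r] w IH] g c n.
  move=> _ _ cg /= cn n0 _; split=> // i le; right; exists g, 0%N, n; split=> //.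
    by rewrite mulVg; exact: sub_amalgam (subgroup1 HQ).
  by rewrite cn; apply: near_coset_mem.
move=> okw redw cg cn n0 start.
have := @entrance_from_end w g q rho r q' _ okw redw Qq'; rewrite -cn.
set Y := lcoset_set (g * q) (pcoset rho) in start * => finish.
have [Qq Hrho Nr ok] := okw; have [nQr neq red] := redw.
have HY : is_coset P Y by exact: step_is_coset.
have sep z z' : entrance P Y (c 0%N) z -> entrance P Y (c n) z' ->
    (C < wlen (z^-1 * z') + 4 * B)%N.
  move=> /start[s [Ys ns zs]] /finish[s' [Ys' ns' zs']].
  have := N_far Hrho Nr nQr Ys Ys' (iffRL (near_cosetM _ _ _ Qq) ns) ns'.
  have := wlen_triangle S z s s'; have := wlen_triangle S z' z s'.
  by rewrite (wlenC S s z); len_lia.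
have [z ez] := entrance_ex (c 0%N) HY; have [z' ez'] := entrance_ex (c n) HY.
have [k [kn Yk]] : exists k, (k <= n)%N /\ Y (c k).
  apply: contrapT => no; have : (wlen (z^-1 * z') <= B)%N.
    by apply: (B_avoid HY ez ez' cg) => // k kn Yk; apply: no; exists k.
  by have := sep z z' ez ez'; len_lia.
have [i [ik Yi ei]] := entrance_first cg kn Yk.
have [j [kj Yj ej]] := entrance_last cg kn Yk.
have long := sep _ _ ei ej.
have [s [Ys ns zs]] := start _ ei; have [s' [Ys' ns' zs']] := finish _ ej.
(* Points of [Y] are at distance at most 1, and [i = j] is excluded by the length of the jump: the
   crossing is a single edge. *)
have eij : j = i.+1.
  have := coset_dist HY Yi Yj; rewrite cg; last by lia.
  have : i <> j by move=> e; move: long; rewrite e mulVg wlen1; len_lia.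
  by lia.
have ni : near_coset K' g (c i).
  apply: (@near_coset_le (K + 2 * B)); first by rewrite /K'; lia.
  by apply: near_coset_trans ns _; rewrite wlenC.
have nj : near_coset K' (g * q * r) (c j).
  apply: (@near_coset_le (K + 2 * B)); first by rewrite /K'; lia.
  by apply: near_coset_trans ns' _; rewrite wlenC.
have Hq : amalgam (g^-1 * (g * q)) by rewrite mulKg; apply: sub_amalgam.
have Hqr : amalgam (g^-1 * (g * q * r)).
  rewrite -mulgA mulKg; apply: amalgam_Ql => //.
  exact: N_sub_amalgam Nr.
have jn : (j <= n)%N by case/andP: kj.
split; last by move=> _; exists i, j; split=> //; lia.
have [||||||IHtame _] := IH (g * q * r) (fun t => c (j + t)%N) (n - j)%N.
- by [].
- by [].
- by apply: geod_shift cg _; lia.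
- by rewrite subnKC // cn /= !mulgA.
- by rewrite addn0.
- case: w {IH okw redw cn finish} ok red neq => [|[[q2 rho2] r2] w] //.
  move=> [Qq2 Hrho2 Nr2 _] _ neq z0; rewrite addn0 => ez0.
  have [u [u' [t [t' [Yu Yu' [Yt Yt'] [et nt] [et' nt']]]]]] :=
    two_steps_bridge g q Hrho Nr Qq2 Hrho2.
  exists t'; split=> //; apply: (@leq_trans B); last by lia.
  by apply: (B_coset HY _ (@two_steps_neq g q rho r q2 rho2 Hrho Nr neq) Yj Yu ez0 et');
    apply: step_is_coset.
move=> t tn; have [ti|it|->] := ltngtP t i.
- right; exists g, 0%N, i; split=> //; last by lia.
  by rewrite mulVg; exact: sub_amalgam (subgroup1 HQ).
- have [|[h [h' [rho' [[Hh Hh'] Hr' Yh Yh' [nh nh']]]]]|[h [a [b [Hh ab bn na nb]]]]] :=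
    IHtame (t - j)%N; first by lia.
    left; exists h, h', rho'; move: Yh Yh' nh nh'.
    have -> : (j + (t - j) = t)%N by lia.
    have -> : (j + (t - j).+1 = t.+1)%N by lia.
    move=> Yh Yh' nh nh'; split=> //; split.
      have := amalgamM Hqr Hh; by gsimp.
    have := amalgamM Hqr Hh'; by gsimp.
  right; exists h, (j + a)%N, (j + b)%N; split=> //; try lia.
  have := amalgamM Hqr Hh; by gsimp.
left; exists (g * q), (g * q * r), rho; rewrite -eij; split=> //.
by split=> //; apply/near_cosetM.
Qed.

Lemma amalgam_geodesic c n g h : amalgam h -> geod c n -> c 0%N = g ->
  c n = g * h ->
  (forall i, (i < n)%N -> tame g c n i) /\
  (~ Q h -> exists i j, [/\ (i <= n)%N, (j <= n)%N &
     (C < wlen ((c i)^-1 * c j) + 4 * B)%N]).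
Proof.
move=> Hh cg c0 cn; have [w [q [ok red Qq eh]]] := amalgam_reduced Hh.
rewrite eh in cn.
have near1 k : near_coset k g g.
  by exists 1; [exact: subgroup1|rewrite mulg1 mulVg wlen1].
have [||tm long] := geodesic_tame ok red Qq cg cn.
- by rewrite c0; apply: near1.
- case: w ok {red cn eh} => [|[[q1 rho] r] w] //= [Qq1 Hrho _ _] z ez.
  have [Yu nu] := step_base g Qq1 Hrho.
  apply: entrance_near nu Yu ez => //.
  by rewrite c0; apply: near1.
split=> // nQh; apply: long => e; apply: nQh.
by rewrite eh e.
Qed.

(** * Quasiconvexity of the generated subgroup and its intersections with parabolics *)

Lemma near_coset_amalgam L h x : amalgam h -> near_coset L h x ->
  exists2 w, amalgam w & (wlen (x^-1 * w) <= L)%N.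
Proof.
move=> Hh [q Qq le]; exists (h * q); last by rewrite wlenC.
by apply: amalgamM => //; apply: sub_amalgam.
Qed.

Lemma amalgam_quasiconvex L c n :
  (forall g u n, geod u n -> near_coset K' g (u 0%N) -> near_coset K' g (u n) ->
     forall i, (i <= n)%N -> near_coset L g (u i)) ->
  geod c n -> amalgam (c 0%N) -> amalgam (c n) -> forall i, (i <= n)%N ->
  exists2 w, amalgam w & (wlen ((c i)^-1 * w) <= K' + L)%N.
Proof.
move=> hull cg H0 Hn i; rewrite leq_eqVlt => /orP[/eqP ->|le].
  by exists (c n) => //; rewrite mulVg wlen1.
have HH := amalgam_subgroup.
have H0n : amalgam ((c 0%N)^-1 * c n) by apply: subgroupM HH (subgroupV HH H0) Hn.
have [tm _] := amalgam_geodesic H0n cg erefl (esym (mulVKg _ _)).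
have inH h : amalgam ((c 0%N)^-1 * h) -> amalgam h.
  by move=> Hh; have := subgroupM HH H0 Hh; rewrite mulVKg.
case: (tm i le) => [[h [h' [rho [[Hh _] _ _ _ [nh _]]]]]|].
  have [w Hw wn] := near_coset_amalgam (inH _ Hh) nh.
  by exists w => //; apply: leq_trans wn _; apply: leq_addr.
move=> [h [a [b [Hh ab bn na nb]]]].
have [||||j] := hull h (fun t => c (a + t)%N) (b - a)%N _ _ _ (i - a)%N.
- by apply: geod_shift cg _; lia.
- by rewrite addn0.
- by rewrite subnKC //; lia.
- by rewrite leq_sub2r //; lia.
rewrite subnKC; last by case/andP: ab.
move=> jq le'; have [w Hw wn] := near_coset_amalgam (inH _ Hh) (ex_intro2 _ _ j jq le').
by exists w => //; apply: leq_trans wn _; apply: leq_addl.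
Qed.

(** If the long edge crosses a chosen coset, two cosets share a long edge and agree. If it belongs
    to a piece following [h Q], coset penetration puts [Y] within [sigma] of [h Q], so an element of
    [Q] carries a translate of it to a representative. *)
Lemma amalgam_penetrates D c n Y i :
  (forall g u n i Y, geod u n -> near_coset K' g (u 0%N) -> near_coset K' g (u n) ->
     is_coset P Y -> (i < n)%N -> Y (u i) -> Y (u i.+1) ->
     (D < wlen ((u i)^-1 * u i.+1))%N -> exists2 y, Y y & near_coset sigma g y) ->
  (forall Y' x y, is_coset P Y' -> Y x -> Y y -> Y' x -> Y' y ->
     (D < wlen (x^-1 * y))%N -> Y = Y') ->
  (forall M f, maximal_parabolic P M -> (wlen f <= sigma)%N ->
     exists rho q, [/\ rep rho, Q q & pcoset rho = lcoset_set q (pcoset (M, f))]) ->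
  is_coset P Y -> geod c n -> c 0%N = 1 -> amalgam (c n) ->
  (i < n)%N -> Y (c i) -> Y (c i.+1) -> (D < wlen ((c i)^-1 * c i.+1))%N ->
  exists h rho, [/\ amalgam h, rep rho & Y = lcoset_set h (pcoset rho)].
Proof.
move=> Qlong inter rep_ex HY cg c0 Hn le Yi Yi' big.
have cn : c n = 1 * c n by rewrite mul1g.
have [tm _] := amalgam_geodesic Hn cg c0 cn.
case: (tm i le) => [[h [h' [rho [[Hh _] Hrho Yh Yh' _]]]]|].
  rewrite invg1 mul1g in Hh; exists h, rho; split=> //.
  by apply: (inter _ (c i) (c i.+1)) => //; apply/pcoset_is_coset/rep_maximal.
move=> [h [a [b [Hh ab bn na nb]]]]; rewrite invg1 mul1g in Hh.
have [y Yy [q Qq ny]] : exists2 y, Y y & near_coset sigma h y.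
  have e1 : (a + (i - a) = i)%N by lia.
  have e2 : (a + (i - a).+1 = i.+1)%N by lia.
  apply: (Qlong h (fun t => c (a + t)%N) (b - a)%N (i - a)%N) => //.
  - by apply: geod_shift cg _; lia.
  - by rewrite addn0.
  - by rewrite subnKC //; lia.
  - by lia.
  - by rewrite e1.
  - by rewrite e2.
  - by rewrite e1 e2.
have [M HM eY] := coset_hull HY Yy.
have [rho [q' [Hrho Qq' e]]] := rep_ex M _ HM ny.
exists (h * q * q'^-1), rho; split=> //.
  rewrite -mulgA; apply: amalgamM => //; apply: sub_amalgam.
  exact: subgroupM HQ Qq (subgroupV HQ Qq').
by rewrite e -!lcoset_setM /= eY; gsimp.
Qed.

Lemma amalgam_finite_index h rho T : amalgam h -> rep rho ->
  cov S (pstab rho) (N rho) -> is_subgroup T ->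
  (forall x, T x -> lcoset_set x (lcoset_set h (pcoset rho)) =
     lcoset_set h (pcoset rho)) ->
  finite_index (amalgam `&` T) T.
Proof.
move=> Hh Hrho covN HT stabT; have HH := amalgam_subgroup.
have Tsub : T `<=` conj_set h (pstab rho).
  move=> x /stabT e; apply/conj_setP/pstabP; first exact: rep_maximal.
  by apply: (@lcoset_set_inj h); rewrite -lcoset_setM -e -lcoset_setM; gsimp.
have HN := subgroup_conj h (N_subgroup Hrho).
apply: finite_index_cov => //; first exact: subgroupI.
have : cov S T (T `&` conj_set h (N rho)).
  by apply: cov_subgroupI => //; apply: cov_subl Tsub _; apply: cov_conj.
apply: cov_subr => x [Tx /conj_setP Nx]; split=> //.
have := subgroupM HH (subgroupM HH Hh (N_sub_amalgam Hrho Nx)) (subgroupV HH Hh).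
by gsimp.
Qed.

End Combination.

(** * Fully quasiconvex overgroups *)

Section FullyQuasiconvex.

Context (R : realType) (G : groupType) (S : fin_gen_set G) (m : nat).
Context (P : rel_hyp_family R S m).
Context (P_slender : forall i, slender (P i)) (P_LERF : forall i, LERF (P i)).
Context (Q : set G) (Q_qc : relatively_quasiconvex R S P Q).

Local Notation wlen := (wlen S).
Local Notation d := (cayley_dist S P).
Local Notation geod := (geod P).
Local Notation near_coset := (near_coset S Q).
Local Notation pcoset := (pcoset P).
Local Notation pstab := (pstab P).

Let HQ : is_subgroup Q := Q_qc.1.

Lemma quasiconvex_geod : exists sigma, forall g c n, geod c n ->
  lcoset_set g Q (c 0%N) -> lcoset_set g Q (c n) ->
  forall i, (i <= n)%N -> near_coset sigma g (c i).
Proof.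
have [_ [sg sg0 qc]] := Q_qc; exists (Num.bound sg).
move=> g c n cg /lcoset_setP Q0 /lcoset_setP Qn i le.
have vg : geod (fun k => g^-1 * c k) n.
  by move=> a b abn; rewrite cdistMl; apply: cg.
have [tau ok] := geod_labelled_ex vg.
have [|w Qw] := qc _ _ _ Q0 Qn (mkpath_geodesic ok vg) i; first by rewrite cp_len_mkpath.
rewrite cp_vertex_mkpath // wlen_dist => ws; exists w => //.
rewrite wlenC; have -> : (c i)^-1 * (g * w) = (g^-1 * c i)^-1 * w by gsimp.
by rewrite -(@ler_nat R); apply: le_trans ws _; apply/ltW/archi_boundP.
Qed.

(** The geodesic is compared with one whose ends lie in [g Q]. In the second part the distance from
    [Y] to [g Q] is [sigma] whatever [K] is; so the representatives can be fixed before the larger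
    constant [K + sigma + 2 * B] is known. *)
Lemma quasiconvex_hull sigma K :
  (forall g c n, geod c n -> lcoset_set g Q (c 0%N) -> lcoset_set g Q (c n) ->
    forall i, (i <= n)%N -> near_coset sigma g (c i)) ->
  exists L, (forall g u n, geod u n -> near_coset K g (u 0%N) ->
      near_coset K g (u n) -> forall i, (i <= n)%N -> near_coset L g (u i)) /\
    (forall g u n i Y, geod u n -> near_coset K g (u 0%N) -> near_coset K g (u n) ->
      is_coset P Y -> (i < n)%N -> Y (u i) -> Y (u i.+1) ->
      (L < wlen ((u i)^-1 * u i.+1))%N -> exists2 y, Y y & near_coset sigma g y).
Proof.
move=> qc; have [eps Heps] := BCP_geod P K; have [N HN] := coset_long P.
exists (sigma + eps + N)%N.
have tracked g u n : geod u n -> near_coset K g (u 0%N) -> near_coset K g (u n) ->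
    exists c l, [/\ geod c l, (wlen ((u 0%N)^-1 * c 0%N) <= K)%N,
      (wlen ((u n)^-1 * c l) <= K)%N &
      forall j, (j <= l)%N -> near_coset sigma g (c j)].
  move=> ug [q0 Qq0 le0] [q1 Qq1 le1].
  have [c [l [cg c0 cl]]] := geod_ex P (g * q0) (g * q1).
  exists c, l; split=> //; first by rewrite c0 wlenC.
    by rewrite cl wlenC.
  by apply: qc => //; rewrite ?c0 ?cl; [exists q0|exists q1].
split=> [g u n ug n0 nn i le|g u n i Y ug n0 nn HY le Yi Yi' big].
  have [c [l [cg d0 dl nc]]] := tracked g u n ug n0 nn.
  have [near _] := Heps u n c l ug cg d0 dl.
  have [j jl dj] := near i le.
  apply: (@near_coset_le _ _ _ (sigma + eps)); first by lia.
  by apply: near_coset_trans (nc j jl) _; rewrite wlenC.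
have [c [l [cg d0 dl nc]]] := tracked g u n ug n0 nn.
have [_ pen] := Heps u n c l ug cg d0 dl.
have [k Pk] := coset_alphabet HY Yi Yi'.
have [|k' [j [jl Pk' Pk'']]] := pen i k le Pk; first by len_lia.
exists (c j); last exact: nc.
by apply: HN HY Yi Yi' Pk' _ Pk''; len_lia.
Qed.

(** Several pairs may describe one coset. [pick] sees only the orbit as a set, so pairs with the
    same orbit get the same representative. *)
Lemma representatives sigma : exists rep : 'I_m * G -> Prop,
  [/\ forall rho, rep rho -> maximal_parabolic P rho.1 /\ (wlen rho.2 <= sigma)%N,
      forall rho rho' q, rep rho -> rep rho' -> Q q ->
        pcoset rho = lcoset_set q (pcoset rho') -> rho = rho' &
      forall M f, maximal_parabolic P M -> (wlen f <= sigma)%N ->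
        exists rho q, [/\ rep rho, Q q & pcoset rho = lcoset_set q (pcoset (M, f))]].
Proof.
have /choice[pick pickP] : forall A : set ('I_m * G), exists rho,
    forall x, A x -> exists2 y, rho = Some y & A y.
  move=> A; have [[x Ax]|no] := pselect (exists x, A x).
    by exists (Some x) => _ _; exists x.
  by exists None => x Ax; case: no; exists x.
pose valid rho := maximal_parabolic P rho.1 /\ (wlen rho.2 <= sigma)%N.
pose orb rho := [set rho' | valid rho' /\
  exists2 q, Q q & pcoset rho' = lcoset_set q (pcoset rho)].
have orb_eq rho rho' q : Q q -> pcoset rho = lcoset_set q (pcoset rho') ->
    orb rho = orb rho'.
  move=> Qq e; apply/seteqP; split=> x [vx [p Qp ex]]; split=> //.
    exists (p * q); first exact: subgroupM HQ Qp Qq.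
    by rewrite ex e lcoset_setM.
  exists (p * q^-1); first exact: subgroupM HQ Qp (subgroupV HQ Qq).
  by rewrite ex e -lcoset_setM mulgVK.
exists (fun rho => valid rho /\ pick (orb rho) = Some rho); split.
- by move=> rho [].
- move=> rho rho' q [_ e] [_ e'] Qq eq; apply: (can_inj (g := odflt rho) (f := Some)) => //.
  by rewrite -e -e' (orb_eq _ _ _ Qq eq).
move=> M f HM fs.
have orbM : orb (M, f) (M, f).
  by split=> //; exists 1; [exact: subgroup1|rewrite lcoset_set1].
have [rho e [vrho [q Qq eq]]] := pickP _ _ orbM.
by exists rho, q; split=> //; split=> //; rewrite (orb_eq _ _ _ Qq eq).
Qed.

(** The separation takes place in the hull and is conjugated by [f], which costs [2 * wlen f] in
    length. *)
Lemma stabilizer_subgroups C : exists N : 'I_m * G -> set G,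
  forall rho, maximal_parabolic P rho.1 ->
  [/\ is_subgroup (N rho), N rho `<=` pstab rho, Q `&` pstab rho `<=` N rho,
      cov S (pstab rho) (N rho) & forall x, N rho x -> ~ Q x -> (C < wlen x)%N].
Proof.
suff /choice[N HN] : forall rho : 'I_m * G, exists N, maximal_parabolic P rho.1 ->
  [/\ is_subgroup N, N `<=` pstab rho, Q `&` pstab rho `<=` N,
      cov S (pstab rho) N & forall x, N x -> ~ Q x -> (C < wlen x)%N].
  by exists N.
move=> [M f] /=; have [HM|nHM] := pselect (maximal_parabolic P M); last by exists setT.
have HE := hull_subgroup HM.
have PE : P M `<=` hull P M by move=> x Px; exists M => //; exact: cov_refl.
pose L := [set x | hull P M x /\ Q (f * x * f^-1)].
have HL : is_subgroup L.
  split; first by split; [exact: subgroup1|gsimp; exact: subgroup1].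
  move=> x y [Ex Qx] [Ey Qy]; split; first exact: HE.2.
  by have := HQ.2 _ _ Qx Qy; gsimp.
have [N [HN LN NE EN avoid]] := LERF_overgroup_avoid_ball (C + 2 * wlen f)
  HE (rhf_subgroup P M) PE (hull_cov HM) (@P_slender M) (@P_LERF M) HL
  (fun x (h : L x) => proj1 h).
exists (conj_set f N) => _; split.
- exact: subgroup_conj.
- by move=> x /conj_setP Nx; apply/conj_setP/NE.
- move=> x [Qx /conj_setP Ex]; apply/conj_setP/LN; split=> //.
  by gsimp.
- exact: cov_conj.
move=> x /conj_setP Nx nQx.
have : (C + 2 * wlen f < wlen (f^-1 * x * f))%N.
  by apply: avoid => // -[_]; gsimp.
have := wlenM S (f^-1 * x) f; have := wlenM S f^-1 x; rewrite wlenV; len_lia.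
Qed.

Lemma near_stabilizer sigma K : exists L, forall rho q x,
  maximal_parabolic P rho.1 -> (wlen rho.2 <= sigma)%N -> Q q -> pcoset rho x ->
  (wlen (q^-1 * x) <= K)%N ->
  exists2 e, (Q `&` pstab rho) e & (wlen (e^-1 * q) <= L)%N.
Proof.
have [|||L HL] := @uniform_bound ('I_m * G)%type
  (setT `*` [set f | (wlen f <= sigma)%N]) (fun rho L => forall q x,
  maximal_parabolic P rho.1 -> (wlen rho.2 <= sigma)%N -> Q q -> pcoset rho x ->
  (wlen (q^-1 * x) <= K)%N ->
  exists2 e, (Q `&` pstab rho) e & (wlen (e^-1 * q) <= L)%N).
- by apply: finite_setX; [exact: finite_finset|exact: finite_wlen_ball].
- move=> rho L L' LL' HL q x HM fs Qq Yx le; have [e He le'] := HL q x HM fs Qq Yx le.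
  by exists e => //; apply: leq_trans LL'.
- move=> rho _; have [HM|nHM] := pselect (maximal_parabolic P rho.1); last by exists 0%N.
  have [L HL] := subgroup_near_both S (sigma + K) HQ (pstab_subgroup HM).
  exists L => q x _ fs Qq /lcoset_setP Ex le; apply: (HL q (x * rho.2^-1)) => //.
    by apply/conj_setP; gsimp.
  have -> : (x * rho.2^-1)^-1 * q = rho.2 * (x^-1 * q) by gsimp.
  have := wlenM S rho.2 (x^-1 * q); rewrite (wlenC S x q); len_lia.
by exists L => rho q x HM fs; apply: (HL rho).
Qed.

(** [x] and [y] are close to [h * e] and [h * r * e'] with [e], [e'] stabilizing elements of [Q].
    Then [e^-1 * r * e'] is in [N] but not in [Q], hence long. *)
Lemma stabilizer_far sigma K C : exists C', forall rho r h x y (N : set G),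
  maximal_parabolic P rho.1 -> (wlen rho.2 <= sigma)%N ->
  is_subgroup N -> N `<=` pstab rho -> Q `&` pstab rho `<=` N ->
  (forall z, N z -> ~ Q z -> (C' < wlen z)%N) -> N r -> ~ Q r ->
  lcoset_set h (pcoset rho) x -> lcoset_set h (pcoset rho) y ->
  near_coset K h x -> near_coset K (h * r) y -> (C < wlen (x^-1 * y))%N.
Proof.
have [L HL] := near_stabilizer sigma K; exists (C + 2 * K + 2 * L)%N.
move=> rho r h x y N HM fs HN NE QN avoid Nr nQr /lcoset_setP Yx /lcoset_setP Yy.
move=> [q Qq dq] [q' Qq' dq'].
have Yy' : pcoset rho (r^-1 * (h^-1 * y)).
  have /pstabP e : pstab rho r by apply: NE.
  by move: Yy; rewrite -{1}(e HM) => /lcoset_setP.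
have [|e [Qe Ee] de] := HL rho q (h^-1 * x) HM fs Qq Yx; first by move: dq; gsimp.
have [|e' [Qe' Ee'] de'] := HL rho q' (r^-1 * (h^-1 * y)) HM fs Qq' Yy'.
  by move: dq'; gsimp.
have Ne := QN _ (conj Qe Ee); have Ne' := QN _ (conj Qe' Ee').
have : (C + 2 * K + 2 * L < wlen (e^-1 * r * e'))%N.
  apply: avoid.
    exact: subgroupM HN (subgroupM HN (subgroupV HN Ne) Nr) Ne'.
  move=> Qx; apply: nQr.
  have := subgroupM HQ (subgroupM HQ Qe Qx) (subgroupV HQ Qe'); by gsimp.
have h1 : (wlen ((h * e)^-1 * (h * q)) <= L)%N by move: de; gsimp.
have h2 : (wlen ((h * r * q')^-1 * (h * r * e')) <= L)%N.
  by rewrite wlenC; move: de'; gsimp.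
have -> : e^-1 * r * e' = (h * e)^-1 * (h * r * e') by gsimp.
have := wlen_triangle S (h * q) (h * e) (h * r * e').
have := wlen_triangle S x (h * q) (h * r * e').
have := wlen_triangle S y x (h * r * e').
have := wlen_triangle S (h * r * q') y (h * r * e').
by rewrite (wlenC S y (h * r * q')); len_lia.
Qed.

Lemma geod_diameter (c : nat -> G) n : exists D, forall i j, (i <= n)%N -> (j <= n)%N ->
  (wlen ((c i)^-1 * c j) <= D)%N.
Proof.
exists (\max_(i < n.+1) \max_(j < n.+1) wlen ((c i)^-1 * c j)) => i j le jn.
apply: leq_trans (leq_bigmax (Ordinal (le : i < n.+1)%N)).
exact: (leq_bigmax (Ordinal (jn : j < n.+1)%N)).
Qed.

Lemma quasiconvex_separation g : ~ Q g ->
  exists H : set G, [/\ fully_quasiconvex R S P H, Q `<=` H & ~ H g].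
Proof.
move=> nQg.
have [sigma qc] := quasiconvex_geod.
have [K [Q_hull _]] := quasiconvex_hull sigma qc.
have [B1 avoid1] := avoid_bound P; have [B2 unique2] := entrance_unique P.
have [B3 coset3] := entrance_coset_bound P.
pose B := (B1 + B2 + B3)%N.
have [c0 [n0 [cg0 c00 c0n]]] := geod_ex P 1 g.
have [D0 HD0] := geod_diameter c0 n0.
(* Adding [D0] makes every jump longer than the diameter of a fixed geodesic from 1 to [g], which
   keeps [g] out of the subgroup. *)
have [C' far] := stabilizer_far sigma K (5 * B + D0).
have [N HN] := stabilizer_subgroups C'.
have [rep [rep_valid rep_unique rep_ex]] := representatives sigma.
have rep_maximal rho : rep rho -> maximal_parabolic P rho.1 by case/rep_valid.
have rep_short rho : rep rho -> (wlen rho.2 <= sigma)%N by case/rep_valid.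
have N_subgroup rho : rep rho -> is_subgroup (N rho).
  by move=> /rep_maximal /HN[].
have N_stab rho : rep rho -> N rho `<=` pstab rho by move=> /rep_maximal /HN[].
have N_Q rho : rep rho -> Q `&` pstab rho `<=` N rho by move=> /rep_maximal /HN[].
have N_far rho r h x y : rep rho -> N rho r -> ~ Q r ->
    lcoset_set h (pcoset rho) x -> lcoset_set h (pcoset rho) y ->
    near_coset K h x -> near_coset K (h * r) y ->
    (5 * B + D0 < wlen (x^-1 * y))%N.
  move=> Hrho; have [? ? ? _ ?] := HN _ (rep_maximal _ Hrho).
  by apply: (far rho r h x y (N rho)) => //; [exact: rep_maximal|exact: rep_short].
have B_avoid Y x y z z' c lc : is_coset P Y -> entrance P Y x z ->
    entrance P Y y z' -> geod c lc -> c 0%N = x -> c lc = y ->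
    (forall k, (k <= lc)%N -> ~ Y (c k)) -> (wlen (z^-1 * z') <= B)%N.
  move=> HY ez ez' cg e0 en no.
  by have := avoid1 Y x y z z' c lc HY ez ez' cg e0 en no; rewrite /B; len_lia.
have B_unique Y x z z' : is_coset P Y -> entrance P Y x z ->
    entrance P Y x z' -> (wlen (z^-1 * z') <= B)%N.
  by move=> HY ez ez'; have := unique2 Y x z z' HY ez ez'; rewrite /B; len_lia.
have B_coset Y Y' x x' z z' : is_coset P Y -> is_coset P Y' ->
    Y <> Y' -> Y x -> Y x' -> entrance P Y' x z -> entrance P Y' x' z' ->
    (wlen (z^-1 * z') <= B)%N.
  move=> HY HY' YY' Yx Yx' ez ez'.
  by have := coset3 Y Y' x x' z z' HY HY' YY' Yx Yx' ez ez'; rewrite /B; len_lia.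
have C_large : (5 * B <= 5 * B + D0)%N by apply: leq_addr.
have HH := amalgam_subgroup (rep := rep) HQ N_subgroup.
exists (amalgam Q rep N); split; last first.
- move=> Hg.
  have [|_ [//|i [j [le jn]]]] := amalgam_geodesic HQ Q_hull B_avoid B_unique B_coset
    rep_maximal rep_short rep_unique N_subgroup N_stab N_Q N_far C_large Hg cg0 c00.
    by rewrite mul1g.
  by have := HD0 i j le jn; len_lia.
- exact: sub_amalgam.
have [L [hull_L pen_L]] := quasiconvex_hull (K + sigma + 2 * B) qc.
split.
  split=> //; exists ((K + sigma + 2 * B) + L)%N%:R%R; first exact: ler0n.
  move=> f h p Hf Hh /geodesic_geod[pg p0 pn] a an.
  have [||w Hw wn] := amalgam_quasiconvex HQ Q_hull B_avoid B_unique B_coset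
    rep_maximal rep_short rep_unique N_subgroup N_stab N_Q N_far C_large hull_L pg
    _ _ an.
  - by rewrite p0.
  - by rewrite pn.
  by exists w => //; rewrite ler_nat wlen_dist.
move=> k u; have [unb|bdd] := pselect (unbounded S (amalgam Q rep N `&` conj_set u (P k))).
  2: by left; apply: bounded_finite bdd.
right.
have unbP : unbounded S (P k).
  apply: unbounded_sub (unbounded_conj u^-1 unb) => _ [x [_ /conj_setP Px] <-].
  by move: Px; gsimp.
have [M HM kM] := maximal_parabolic_ex unbP.
have PE := parabolic_sub_hull HM unbP kM.
pose Y := pcoset (M, u).
have HY : is_coset P Y by exists M, u.
have stabY x : conj_set u (P k) x -> lcoset_set x Y = Y.
  by move=> /conj_setP Px; apply/pstabP => //; apply/conj_setP/PE.
have [z ez] := entrance_ex 1 HY.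
have [N0 inter] := coset_inter P.
(* As [h] stabilizes [Y], the points 1 and [h] project to [z] and [h * z]. For long [h] these are
   far apart, so a geodesic from 1 to [h] penetrates [Y] deeply and [amalgam_penetrates] applies. *)
have [h [Hh uh] long] := unb (L + N0 + 3 * B + 2 * wlen z)%N.
have ehz : entrance P Y h (h * z).
  by have := entrance_lcoset h ez; rewrite mulg1 stabY.
have [c [n [cg c1 cn]]] := geod_ex P 1 h.
have zhz : (L + N0 + 3 * B < wlen (z^-1 * (h * z)))%N.
  have := wlenM S z (z^-1 * (h * z)); have := wlenM S (z * (z^-1 * (h * z))) z^-1.
  have -> : z * (z^-1 * (h * z)) * z^-1 = h by gsimp.
  by rewrite wlenV; len_lia.
have [j0 [jn0 Yj0]] : exists j, (j <= n)%N /\ Y (c j).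
  apply: contrapT => no; have : (wlen (z^-1 * (h * z)) <= B)%N.
    by apply: (B_avoid _ _ _ _ _ _ _ HY ez ehz cg c1 cn) => j jn Yj; apply: no; exists j.
  by len_lia.
have [i [ij Yi ei]] := entrance_first cg jn0 Yj0; rewrite c1 in ei.
have [j [jj Yj ej]] := entrance_last cg jn0 Yj0; rewrite cn in ej.
have big : (L + N0 < wlen ((c i)^-1 * c j))%N.
  have := B_unique _ _ _ _ HY ez ei; have := B_unique _ _ _ _ HY ehz ej.
  have := wlen_triangle S (c i) z (h * z); have := wlen_triangle S (c j) (c i) (h * z).
  by rewrite (wlenC S (c j)); len_lia.
have eij : j = i.+1.
  have := coset_dist HY Yi Yj; rewrite cg; last by lia.
  have : i <> j by move=> e; move: big; rewrite e mulVg wlen1; len_lia.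
  by lia.
rewrite eij in Yj big jj.
have [|||||||h' [rho [Hh' Hrho eY]]] := @amalgam_penetrates _ _ _ _ _ _ HQ _ _ _ _ _ _
  Q_hull B_avoid B_unique B_coset rep_maximal rep_short rep_unique N_subgroup N_stab
  N_Q N_far C_large (L + N0) c n Y i _ _ rep_ex HY cg c1.
- move=> g1 v l i1 Y1 vg n1 n2 HY1 le1 Y1i Y1i' big1.
  by apply: (pen_L g1 v l i1) => //; len_lia.
- move=> Y' x y HY' Yx Yy Y'x Y'y long'.
  by apply: (inter Y Y' x y) => //; len_lia.
- by rewrite cn.
- by lia.
- by [].
- by [].
- by len_lia.
have [? ? ? covN _] := HN _ (rep_maximal _ Hrho).
apply: (amalgam_finite_index HQ rep_maximal N_subgroup Hh' Hrho covN).
  by apply: subgroup_conj; apply: rhf_subgroup.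
by move=> x /stabY; rewrite eY.
Qed.

End FullyQuasiconvex.

Theorem theorem1p7 (R : realType) (G : groupType) (S : set G)
    (S_finite : finite_set S) (S_symmetric : symmetric_set S)
    (S_generates : generates S)
    (m : nat) (P : 'I_m -> set G)
    (P_subgroup : forall i, is_subgroup (P i))
    (P_slender : forall i, slender (P i))
    (P_LERF : forall i, LERF (P i))
    (G_hyperbolic : relatively_hyperbolic R S P)
    (Q : set G) (Q_quasiconvex : relatively_quasiconvex R S P Q)
    (g : G) (g_notin_Q : ~ Q g) :
  exists H : set G, [/\ fully_quasiconvex R S P H, Q `<=` H & ~ H g].
Proof.
pose S' := FinGenSet (fgs_sym_gen_set := SymGenSet S_symmetric S_generates) S_finite.
pose P' : rel_hyp_family R S' m := RelHypFamily P_subgroup G_hyperbolic.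
exact: (@quasiconvex_separation R G S' m P' P_slender P_LERF Q Q_quasiconvex g g_notin_Q).
Qed.
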